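(* Let $F$ be $(\ell,\omega)$-relatively smooth on $\mathcal X\cap\mathcal S$ for some $\ell>0$, and let the stochastic oracle satisfy, for every $x\in\mathcal X$, $\mathbb{E}_\xi[\nabla f(x,\xi)]=\nabla F(x)$ and that the random variable $\|\nabla f(x,\xi)-\nabla F(x)\|_*$ is $\sigma$-sub-Gaussian. Run Stochastic Mirror Descent from $x_0\in\mathcal X\cap\mathcal S$: $$x_{t+1}=\arg\min_{x\in\mathcal X}\ \eta_t\big(\langle\nabla f(x_t,\xi_t),x\rangle+r(x)\big)+D_\omega(x,x_t),$$ with $\xi_0,\xi_1,\dots$ i.i.d. from $P$ and non-increasing step-sizes $\{\eta_t\}_{t\ge0}$ with $\eta_0\le1/(2\ell)$. Then for any $\beta\in(0,1)$ and $T\ge1$, with probability at least $1-\beta$, $$\frac{1}{\sum_{t=0}^{T-1}\eta_t}\sum_{t=0}^{T-1}\eta_t\,\mathcal D_{5\ell}(x_t)\le\frac{5\tilde\lambda_0+60\sigma^2\ell\sum_{t=0}^{T-1}\eta_t^2}{2\sum_{t=0}^{T-1}\eta_t},$$ where $\tilde\lambda_0:=3(\Phi(x_0)-\Phi^* )+8\eta_0\sigma^2\log(1/\beta)$.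
   Context: Let $\mathcal X\subseteq\mathbb R^d$ be closed and convex, $\|\cdot\|$ a norm on $\mathbb R^d$ with dual norm $\|z\|_*=\sup_{\|u\|\le1}\langle z,u\rangle$. The problem is $\min_{x\in\mathcal X}\Phi(x):=F(x)+r(x)$, where $F(x)=\mathbb E_{\xi\sim P}[f(x,\xi)]$ is differentiable (possibly nonconvex), $r:\mathbb R^d\to\mathbb R$ is convex, proper and lower semicontinuous, and $\Phi^*:=\inf_{x\in\mathcal X}\Phi(x)>-\infty$. A DGF is $\omega:\mathrm{cl}(\mathcal S)\to\mathbb R$, $\mathcal S$ open with $\mathrm{ri}(\mathcal X)\subseteq\mathcal S$, $\omega$ continuously differentiable on $\mathcal S$ and $1$-strongly convex w.r.t. $\|\cdot\|$ on $\mathrm{cl}(\mathcal S)$; $D_\omega(x,y)=\omega(x)-\omega(y)-\langle\nabla\omega(y),x-y\rangle$. For $\rho>0$: $\mathcal D_\rho(x):=-2\rho\min_{y\in\mathcal X}[\langle\nabla F(x),y-x\rangle+\rho D_\omega(y,x)+r(y)-r(x)]$ (minimizers here and in the algorithm are assumed to exist). $F$ is $(\ell,\omega)$-relatively smooth on $\mathcal X\cap\mathcal S$ if for all $x,y\in\mathcal X\cap\mathcal S$: $-\ell D_\omega(x,y)\le F(x)-F(y)-\langle\nabla F(y),x-y\rangle\le\ell D_\omega(x,y)$. A real random variable $X$ is $\sigma$-sub-Gaussian if $\mathbb E[\exp(\lambda^2X^2)]\le\exp(\lambda^2\sigma^2)$ for all $\lambda\in\mathbb R$ with $|\lambda|\le1/\sigma$.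 *)

(* Defs.v *)
From HB Require Import structures.
From mathcomp Require Import all_boot all_order all_algebra.
From mathcomp Require Import all_classical all_reals all_analysis.
Set Implicit Arguments.
Unset Strict Implicit.
Unset Printing Implicit Defensive.
Import Order.TTheory GRing.Theory Num.Theory.
Import numFieldNormedType.Exports.
Local Open Scope classical_set_scope.
Local Open Scope ring_scope.

Section SMDDefs.
Context {R : realType} {d : nat}.
Local Notation V := 'rV[R]_d.

Definition inner (u v : V) : R := \sum_(i < d) u 0 i * v 0 i.

Definition is_norm (nrm : V -> R) : Prop :=
  [/\ forall x, nrm x = 0 -> x = 0,
      forall (a : R) x, nrm (a *: x) = `|a| * nrm x &
      forall x y, nrm (x + y) <= nrm x + nrm y].

Definition dual_norm (nrm : V -> R) (z : V) : R :=
  sup [set inner z u | u in [set u | nrm u <= 1]].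

Definition affine_hull (X : set V) : set V :=
  [set y | exists n (p : 'I_n -> V) (c : 'I_n -> R),
     [/\ forall i, X (p i), \sum_(i < n) c i = 1 & y = \sum_(i < n) c i *: p i]].

Definition rel_interior (X : set V) : set V :=
  [set x | X x /\ exists2 e : R, 0 < e &
     forall y, affine_hull X y -> `|y - x| < e -> X y].

Definition is_gradient_on (A : set V) (g : V -> R) (dg : V -> V) : Prop :=
  forall x, A x -> differentiable g x /\ forall v : V, 'D_v g x = inner (dg x) v.

(** 1-strong convexity w.r.t. nrm on C (w only meaningful on C) *)
Definition strongly_convex_on (nrm : V -> R) (C : set V) (w : V -> R) : Prop :=
  forall x y (t : R), C x -> C y -> 0 <= t <= 1 -> C (t *: x + (1 - t) *: y) ->
    w (t *: x + (1 - t) *: y) <=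
      t * w x + (1 - t) * w y - t * (1 - t) / 2 * nrm (x - y) ^+ 2.

Definition is_DGF (nrm : V -> R) (X S : set V) (w : V -> R) (dw : V -> V) : Prop :=
  [/\ open S, rel_interior X `<=` S,
      is_gradient_on S w dw, (forall x, S x -> {for x, continuous dw}) &
      strongly_convex_on nrm (closure S) w].

Definition bregman (w : V -> R) (dw : V -> V) (x y : V) : R :=
  w x - w y - inner (dw y) (x - y).

Definition rel_smooth (A : set V) (F : V -> R) (dF : V -> V) (l : R)
  (w : V -> R) (dw : V -> V) : Prop :=
  forall x y, A x -> A y ->
    - l * bregman w dw x y <= F x - F y - inner (dF y) (x - y) <= l * bregman w dw x y.

Definition gap_obj (dF : V -> V) (r : V -> R) (w : V -> R) (dw : V -> V)
  (rho : R) (x y : V) : R :=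
  inner (dF x) (y - x) + rho * bregman w dw y x + r y - r x.

(** D_rho(x) = -2 rho min_{y in X} [...]  (y ranges over X ∩ cl(S), where
    D_w(y,x) is defined; minimizers are assumed to exist) *)
Definition Dgap (X S : set V) (dF : V -> V) (r : V -> R) (w : V -> R)
  (dw : V -> V) (rho : R) (x : V) : R :=
  - 2 * rho * inf [set gap_obj dF r w dw rho x y | y in X `&` closure S].

End SMDDefs.

Section ProbDefs.
Context {R : realType}.
Local Open Scope ereal_scope.

Definition iid_seq {dO dX : measure_display} {O : measurableType dO}
  {Xi : measurableType dX} (P0 : probability O R) (xi : nat -> O -> Xi)
  (P : probability Xi R) : Prop :=
  [/\ forall t, measurable_fun setT (xi t),
      forall t (A : set Xi), measurable A -> P0 (xi t @^-1` A) = P A &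
      forall (I : seq nat) (A : nat -> set Xi), uniq I ->
        (forall i, measurable (A i)) ->
        P0 (\bigcap_(i in [set` I]) (xi i @^-1` A i)) =
        \prod_(i <- I) P0 (xi i @^-1` A i)].

Definition sub_gaussian {dX : measure_display} {Xi : measurableType dX}
  (P : probability Xi R) (Y : Xi -> R) (s : R) : Prop :=
  forall lam : R, (`|lam| <= s^-1)%R ->
    \int[P]_z (expR (lam ^+ 2 * Y z ^+ 2))%:E <= (expR (lam ^+ 2 * s ^+ 2))%:E.

End ProbDefs.

(* Main.v *)
(** Idea.  Put [rho = 4 l] and let [u_t] be an almost minimiser over [X `&` S] of the
    Bregman-Moreau objective [Phi y + rho * D(y, x_t)], with value [a_t].  The
    three-point inequality of the mirror step and relative smoothness give
    [a_{t+1} + rho eta_t Phi(x_{t+1}) <= (1 + rho eta_t) a_t + N_t + eps] where,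
    for the oracle error [e_t] and [v_t = u_t - x_t],
    [N_t = 4 l eta_t <e_t, v_t> + 4 l eta_t^2 |e_t|_*^2 - 6 l^2 eta_t |v_t|^2].
    Since [D_{5l}(x_t) <= 10 l (Phi(x_t) - a_t + eps)], telescoping bounds the
    weighted sum of gaps by [3 (Phi(x_0) - Phi* ) + sum N_t] up to [eps].  The
    negative term of [N_t] pays for the exponential moment of the linear one:
    with [theta = 1 / (8 eta_0 sigma^2)], the conditional expectation of
    [exp (theta (N_t - 10 sigma^2 l eta_t^2))] is at most 1, and Markov's
    inequality applies to the product of these factors.  The constant 10 is
    below the 12 of the statement; the difference absorbs [eps].

    Measurability has to be earned: [x_t] and [u_t] must depend measurably on the
    samples before time [t], and [gf] must be jointly measurable.  The former
    holds because (almost) minimisers can be picked in a countable set, the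
    latter because [gf] is a limit of difference quotients of [f]. *)
Require Import Defs.
From HB Require Import structures.
From mathcomp Require Import all_boot all_order all_algebra.
From mathcomp Require Import all_classical all_reals all_analysis.
From mathcomp Require Import ring lra zify measurable_realfun.
Import Order.TTheory GRing.Theory Num.Theory.
Import numFieldNormedType.Exports.
Set Implicit Arguments.
Unset Strict Implicit.
Unset Printing Implicit Defensive.
Local Open Scope classical_set_scope.
Local Open Scope ring_scope.

(** * Gradients, convexity and the three-point inequality *)

Section Inner.
Context {R : realType} {d : nat}.
Local Notation V := 'rV[R]_d.
Implicit Types u v x y : V.

Lemma innerDl u v y : inner (u + v) y = inner u y + inner v y.
Proof. by rewrite /inner -big_split; apply: eq_bigr => i _; rewrite mxE mulrDl. Qed.

Lemma innerZl (a : R) u y : inner (a *: u) y = a * inner u y.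
Proof. by rewrite /inner big_distrr; apply: eq_bigr => i _; rewrite mxE /= mulrA. Qed.

Lemma innerNl u y : inner (- u) y = - inner u y.
Proof. by rewrite -scaleN1r innerZl mulN1r. Qed.

Lemma innerC u v : inner u v = inner v u.
Proof. by apply: eq_bigr => i _; rewrite mulrC. Qed.

Lemma innerDr u v y : inner y (u + v) = inner y u + inner y v.
Proof. by rewrite !(innerC y) innerDl. Qed.

Lemma innerZr (a : R) u y : inner y (a *: u) = a * inner y u.
Proof. by rewrite !(innerC y) innerZl. Qed.

Lemma inner0r y : inner y 0 = 0.
Proof. by rewrite -(scale0r 0) innerZr mul0r. Qed.

Lemma innerBl u v y : inner (u - v) y = inner u y - inner v y.
Proof. by rewrite innerDl innerNl. Qed.

Lemma innerBr u v y : inner y (u - v) = inner y u - inner y v.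
Proof. by rewrite !(innerC y) innerBl. Qed.

Lemma coord_le_norm v j : `|v 0 j| <= `|v|.
Proof.
rewrite [leRHS]/Num.norm /= mx_normrE.
by apply/bigmax_geP; right; exists (0, j).
Qed.

Lemma norm_le_coord v (c : R) : 0 <= c -> (forall j, `|v 0 j| <= c) -> `|v| <= c.
Proof.
move=> c0 h; rewrite [leLHS]/Num.norm /= mx_normrE.
by apply/bigmax_leP; split=> // -[i j] _ /=; rewrite ord1.
Qed.

Lemma norm_inner_le u v : `|inner u v| <= d%:R * `|u| * `|v|.
Proof.
apply: le_trans (ler_norm_sum _ _ _) _.
apply: (@le_trans _ _ (\sum_(i < d) `|u| * `|v|)).
  by apply: ler_sum => i _; rewrite normrM; apply: ler_pM => //; exact: coord_le_norm.
by rewrite sumr_const card_ord -mulrA mulr_natl.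
Qed.

End Inner.

Section Gradient.
Context {R : realType} {d : nat}.
Local Notation V := 'rV[R]_d.
Variables (A : set V) (g : V -> R) (dg : V -> V).
Hypothesis gradg : is_gradient_on A g dg.

Lemma gradient_expansion (x : V) : A x -> forall e : R, 0 < e ->
  exists2 dl : R, 0 < dl & forall h : V, `|h| < dl ->
    `|g (x + h) - g x - inner (dg x) h| <= e * `|h|.
Proof.
move=> Ax e e0; have [dx dE] := gradg Ax.
have /eqaddoP/(_ e e0) := diff_locally dx.
move=> /nbhs_ballP[dl /= dl0 H]; exists dl => // h hdl.
have /H : ball (0 : V) dl h by rewrite -ball_normE /= sub0r normrN.
by rewrite !fctE /= /shift /= -deriveE // dE [h + x]addrC opprD addrA.
Qed.

(** Dividing by [t] and letting [t] tend to 0 removes the quadratic term. A short segment suffices,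
    which suits a function such as [w] whose gradient is given on an open set only. *)
Lemma gradient_ge (x v : V) (t0 a C : R) : A x -> 0 < t0 ->
  (forall t, 0 < t < t0 -> t * a <= g (x + t *: v) - g x + t ^+ 2 * C) ->
  a <= inner (dg x) v.
Proof.
move=> Ax t00 H; apply/ler_addgt0Pr => e e0.
have v1 : 0 < `|v| + 1 by rewrite ltr_wpDl.
have e2 : 0 < e / 2 / (`|v| + 1) by rewrite !divr_gt0.
have [dl dl0 Hd] := gradient_expansion Ax e2.
have C1 : 0 < `|C| + 1 by rewrite ltr_wpDl.
(* The three bounds keep [t] in the range of the hypothesis, keep [t *: v] in the ball where the
   expansion holds, and make the quadratic term at most [t * (e / 2)]. *)
pose t := Num.min (t0 / 2) (Num.min (dl / 2 / (`|v| + 1)) (e / 2 / (`|C| + 1))).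
have t_gt0 : 0 < t by rewrite !lt_min !divr_gt0.
have tt0 : t < t0 by rewrite gt_min; apply/orP; left; lra.
have tdl : t * (`|v| + 1) <= dl / 2.
  by rewrite -ler_pdivlMr // !ge_min lexx orbT.
have tC : t * (`|C| + 1) <= e / 2.
  by rewrite -ler_pdivlMr // !ge_min lexx !orbT.
have tv : `|t *: v| < dl.
  rewrite normrZ gtr0_norm //.
  have : t * `|v| <= t * (`|v| + 1) by rewrite ler_pM2l // lerDl.
  lra.
have := Hd _ tv; rewrite innerZr ler_norml => /andP[_ h1].
have := H t; rewrite t_gt0 tt0 => /(_ isT) h2.
have h3 : e / 2 / (`|v| + 1) * `|t *: v| <= t * (e / 2).
  rewrite normrZ gtr0_norm // mulrCA ler_pM2l // mulrAC ler_pdivrMr //.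
  by rewrite ler_pM2l ?divr_gt0 // lerDl.
have h4 : t ^+ 2 * C <= t * (e / 2).
  rewrite expr2 -mulrA ler_pM2l //; apply: le_trans tC.
  by rewrite ler_pM2l // (le_trans (ler_norm _)) // lerDl.
rewrite -(ler_pM2l t_gt0); move: h1 h2 h3 h4.
set G := g _ - g _ ; set I := inner _ _; set K := _ * `|t *: v|; set L := t ^+ 2 * C.
rewrite !mulrDr; lra.
Qed.

End Gradient.

Section GradientOpp.
Context {R : realType} {d : nat}.
Local Notation V := 'rV[R]_d.
Variables (A : set V) (g : V -> R) (dg : V -> V).
Hypothesis gradg : is_gradient_on A g dg.

Lemma gradientN : is_gradient_on A (fun x => - g x) (fun x => - dg x).
Proof.
move=> x Ax; have [dx dE] := gradg Ax; split; first exact: differentiableN.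
move=> v; rewrite deriveN; last exact: diff_derivable.
by rewrite dE innerNl.
Qed.

Lemma gradient_le (x v : V) (t0 a C : R) : A x -> 0 < t0 ->
  (forall t, 0 < t < t0 -> g (x + t *: v) - g x <= t * a + t ^+ 2 * C) ->
  inner (dg x) v <= a.
Proof.
move=> Ax t00 H; rewrite -lerN2 -innerNl.
apply: (@gradient_ge _ _ _ _ _ gradientN _ _ t0 _ C) => // t /H; lra.
Qed.

End GradientOpp.

Section Convexity.
Context {R : realType} {d : nat}.
Local Notation V := 'rV[R]_d.
Implicit Types (X : set V).

Lemma convex_set_segment X x y (t : R) : convex_set X -> X x -> X y ->
  0 <= t <= 1 -> X (x + t *: (y - x)).
Proof.
move=> cX Xx Xy /andP[t0 t1].
have := cX y x (Itv01 t0 t1); rewrite !inE => /(_ Xy Xx).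
by rewrite /conv /= /unstable.onem scalerBl scale1r scalerBr addrCA.
Qed.

Lemma convex_function_segment (r : V -> R) x y (t : R) : convex_function setT r ->
  0 <= t <= 1 -> r (x + t *: (y - x)) <= (1 - t) * r x + t * r y.
Proof.
move=> cr /andP[t0 t1].
have := cr (Itv01 t0 t1) y x; rewrite !inE => /(_ I I).
by rewrite /conv /= /unstable.onem scalerBl scale1r scalerBr addrCA [leRHS]addrC.
Qed.

Lemma open_segment (S : set V) x v : open S -> S x ->
  exists2 t0 : R, 0 < t0 & forall t, 0 < t < t0 -> S (x + t *: v).
Proof.
move=> oS Sx; have /nbhs_ballP[e /= e0 H] : nbhs x S by exact: open_nbhs_nbhs.
have v1 : 0 < `|v| + 1 by rewrite ltr_wpDl.
exists (e / (`|v| + 1)); first by rewrite divr_gt0.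
move=> t /andP[t0]; rewrite ltr_pdivlMr // => te; apply: H.
rewrite -ball_normE /= opprD addNKr normrN normrZ gtr0_norm //.
by apply: le_lt_trans te; rewrite ler_pM2l // lerDl.
Qed.

End Convexity.

Section DGF.
Context {R : realType} {d : nat}.
Local Notation V := 'rV[R]_d.
Variables (nrm : V -> R) (X S : set V) (w : V -> R) (dw : V -> V).
Hypothesis Hw : is_DGF nrm X S w dw.

Lemma DGF_segment x y (t : R) : closure S x -> closure S y -> 0 <= t <= 1 ->
  closure S (x + t *: (y - x)) ->
  w (x + t *: (y - x)) <= (1 - t) * w x + t * w y - t * (1 - t) / 2 * nrm (y - x) ^+ 2.
Proof.
case: Hw => _ _ _ _ sc Sx Sy t01.
have -> : x + t *: (y - x) = t *: y + (1 - t) *: x.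
  by rewrite scalerBl scale1r scalerBr addrCA.
by move=> /(sc _ _ _ Sy Sx t01); rewrite [_ * w x + _]addrC.
Qed.

(** Strong convexity along the segment from [x] to [y], divided by its parameter as this tends to 0.
    Only the gradient at [x] enters, so [y] may lie on the boundary of [S]. *)
Lemma bregman_ge x y : S x -> closure S y -> nrm (y - x) ^+ 2 / 2 <= bregman w dw y x.
Proof.
move=> Sx Sy; case: (Hw) => oS _ gw _ _.
have [t0 t00 Ht] := open_segment (y - x) oS Sx.
suff : inner (dw x) (y - x) <= w y - w x - nrm (y - x) ^+ 2 / 2.
  by rewrite /bregman; lra.
apply: (@gradient_le _ _ _ _ _ gw _ _ (Num.min t0 1) _ (nrm (y - x) ^+ 2 / 2)) => //.
  by rewrite lt_min t00 ltr01.
move=> t /andP[tp]; rewrite lt_min => /andP[tt0 t1].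
have Sxt : S (x + t *: (y - x)) by apply: Ht; rewrite tp.
have := @DGF_segment x y t (subset_closure Sx) Sy.
rewrite (ltW tp) (ltW t1) => /(_ isT (subset_closure Sxt)).
set N := nrm _ ^+ 2; move: (w _) (w _) (w _) => a b c; lra.
Qed.

(** Three-point inequality: the first-order optimality of [xp] on the segment towards [y], rewritten
    through [bregman]. Openness of [S] keeps the test points near [xp] inside the domain. *)
Lemma mirror_step (r : V -> R) (eta : R) (g x xp : V) :
  0 <= eta -> convex_set X -> convex_function setT r ->
  S x -> X xp -> S xp ->
  (forall y, X y -> closure S y ->
     eta * (inner g xp + r xp) + bregman w dw xp x <=
     eta * (inner g y + r y) + bregman w dw y x) ->
  forall y, X y ->
    eta * (inner g xp + r xp) + bregman w dw xp x + bregman w dw y xp <=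
    eta * (inner g y + r y) + bregman w dw y x.
Proof.
move=> eta0 cX cr Sx Xp Sp H y Xy; case: (Hw) => oS _ gw _ _.
have [t0 t00 Ht] := open_segment (y - xp) oS Sp.
suff : inner (dw x) (y - xp) - eta * (inner g (y - xp) + r y - r xp) <=
    inner (dw xp) (y - xp).
  by rewrite /bregman !innerBr; lra.
apply: (@gradient_ge _ _ _ _ _ gw _ _ (Num.min t0 1) _ 0) => //.
  by rewrite lt_min t00 ltr01.
move=> t /andP[tp]; rewrite lt_min => /andP[tt0 t1].
have Sxt : S (xp + t *: (y - xp)) by apply: Ht; rewrite tp.
have t01 : 0 <= t <= 1 by rewrite !ltW.
have := H _ (convex_set_segment cX Xp Xy t01) (subset_closure Sxt).
have := ler_wpM2l eta0 (convex_function_segment xp y cr t01).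
rewrite /bregman !(innerDr, innerBr, innerZr).
set r1 := r (_ + _); set w1 := w (_ + _); lra.
Qed.

End DGF.

(** * Relative interior *)

Section RelativeInterior.
Context {R : realType} {d : nat}.
Local Notation V := 'rV[R]_d.
Variable X : set V.
Hypothesis cX : convex_set X.

(** The mass missing from the weights sits on [p0]. The induction splits off the last point and
    rescales the other weights by [1 - l]. *)
Lemma convex_set_sum (p0 : V) (n : nat) (a : 'I_n -> V) (c : 'I_n -> R) :
  X p0 -> (forall i, X (p0 + a i)) -> (forall i, 0 <= c i) -> \sum_i c i <= 1 ->
  X (p0 + \sum_i c i *: a i).
Proof.
move=> Xp0; elim: n a c => [|n IH] a c Xa c0 c1; first by rewrite big_ord0 addr0.
rewrite !big_ord_recr /= in c1 *.
set l := c ord_max in c1 *; set lo := widen_ord _.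
have l0 : 0 <= l by exact: c0.
have s0 : 0 <= \sum_(i < n) c (lo i) by apply: sumr_ge0.
(* If [l] is 1, the other weights vanish, so the division by zero, whose value is 0, does no
   harm. *)
have cE i : (1 - l) * (c (lo i) / (1 - l)) = c (lo i).
  have [l1|l1] := eqVneq (1 - l) 0; last by rewrite mulrCA divff ?mulr1.
  rewrite l1 mul0r; apply/eqP; rewrite eq_sym eq_le c0 andbT.
  apply: (@le_trans _ _ (\sum_(i < n) c (lo i))); last by rewrite -/lo in c1; lra.
  by rewrite (bigD1 i) //= lerDl sumr_ge0.
have Xy : X (p0 + \sum_(i < n) (c (lo i) / (1 - l)) *: a (lo i)).
  apply: IH => [i|i|]; first exact: Xa.
    by rewrite divr_ge0 // subr_ge0 (le_trans _ c1) // lerDr.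
  rewrite -mulr_suml; have [->|l1] := eqVneq (1 - l) 0; first by rewrite invr0 mulr0.
  have l1' : 0 < 1 - l by rewrite lt_neqAle eq_sym l1 subr_ge0 (le_trans _ c1) // lerDr.
  by rewrite ler_pdivrMr // mul1r lerBrDr.
have l01 : 0 <= l <= 1 by rewrite l0 (le_trans _ c1) // lerDr.
have := convex_set_segment cX Xy (Xa ord_max) l01.
set sg := \sum_(i < n) _ in Xy *.
have <- : (1 - l) *: sg = \sum_(i < n) c (lo i) *: a (lo i).
  by rewrite scaler_sumr; apply: eq_bigr => i _; rewrite scalerA cE.
rewrite opprD addrACA subrr add0r scalerBr scalerBl scale1r -!addrA.
by rewrite [l *: _ - _]addrC.
Qed.

Lemma affine_hull_segment (x y : V) (t : R) : X x -> affine_hull X y ->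
  affine_hull X (x + t *: (y - x)).
Proof.
move=> Xx [n [p [c [Xp c1 ->]]]].
exists n.+1, (fun i => if unlift ord0 i is Some j then p j else x).
exists (fun i => if unlift ord0 i is Some j then t * c j else 1 - t); split.
- by move=> i; case: unliftP.
- rewrite big_ord_recl unlift_none; under eq_bigr do rewrite liftK.
  by rewrite -mulr_sumr c1; lra.
- rewrite [RHS]big_ord_recl !unlift_none; under [X in _ = _ + X]eq_bigr do rewrite !liftK -scalerA.
  by rewrite -scaler_sumr scalerBr scalerBl scale1r addrA addrAC.
Qed.

(** Greedy extension: while some [x - p0] lies outside the row space, appending it as a row raises
    the rank, which is at most [d]. The induction is on a bound [m] of the corank. *)
Lemma spanning_points (p0 : V) : X p0 -> exists k (A : 'M[R]_(k, d)),
  (forall i, X (p0 + row i A)) /\ forall x, X x -> (x - p0 <= A)%MS.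
Proof.
move=> Xp0.
suff H m : forall k (A : 'M[R]_(k, d)), (d - \rank A <= m)%N ->
    (forall i, X (p0 + row i A)) -> exists k' (A' : 'M[R]_(k', d)),
  (forall i, X (p0 + row i A')) /\ forall x, X x -> (x - p0 <= A')%MS.
  by apply: (H d 0%N (@const_mx R 0%N d 0)); [rewrite leq_subr | case].
elim: m => [|m IH] k A rA XA.
  exists k, A; split=> // x _; apply: submx_full.
  by rewrite /row_full eqn_leq rank_leq_col -subn_eq0 -leqn0.
have [|/existsNP[x /not_implyP[Xx /negP xA]]] :=
  pselect (forall x, X x -> (x - p0 <= A)%MS); first by exists k, A.
apply: (IH (k + 1)%N (col_mx A (x - p0))); last first.
  move=> i; rewrite -[i]fintype.splitK; case: (fintype.split i) => j /=.
    by rewrite rowKu.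
  by rewrite rowKd ord1 row_id // addrC subrK.
have : (A < col_mx A (x - p0))%MS.
  rewrite ltmxE -addsmxE addsmxSl /=; apply: contra xA.
  by rewrite -addsmxE addsmx_sub => /andP[].
move=> /rank_ltmx; lia.
Qed.

(* The barycentre of [p0] and of points whose differences with [p0] span the
   direction of the affine hull is a relative interior point. *)
Lemma rel_interior_neq0 (p0 : V) : X p0 -> rel_interior X !=set0.
Proof.
move=> Xp0; have [k [A [XA sA]]] := spanning_points Xp0.
pose K : R := k.+1%:R; have K0 : 0 < K by rewrite ltr0n.
have aff_sub q : affine_hull X q -> (q - p0 <= A)%MS.
  move=> [n [p [c [Xp c1 ->]]]].
  rewrite -[p0]scale1r -c1 scaler_suml -sumrB; apply: summx_sub => i _.
  by rewrite -scalerBr; apply: scalemx_sub; exact: sA.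
pose s := \sum_(i < k) K^-1 *: row i A.
have sE (c : 'rV[R]_k) : c *m A = \sum_i c 0 i *: row i A by rewrite mulmx_sum_row.
have sM : (s <= A)%MS.
  by apply: summx_sub => i _; apply: scalemx_sub; exact: row_sub.
have Ksum : \sum_(i < k) K^-1 = k%:R / K by rewrite sumr_const card_ord mulr_natl.
have kK : k%:R + 1 = K by rewrite /K -natr1.
exists (p0 + s); split.
  apply: convex_set_sum => // [i|]; first by rewrite invr_ge0 ltW.
  by rewrite Ksum ler_pdivrMr // mul1r -kK lerDl.
(* The pseudo-inverse reads off coordinates along the rows of [A] linearly. The radius below forces
   the coordinates of [q] relative to the barycentre to be at most [K^-1 ^+ 2], which keeps all
   weights nonnegative and their sum at most 1. *)
pose M := pinvmx A.
pose B : R := \sum_j \sum_i `|M j i|.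
have B0 : 0 <= B by apply: sumr_ge0 => j _; apply: sumr_ge0.
exists (K^-1 ^+ 2 / (B + 1)); first by rewrite divr_gt0 ?exprn_gt0 ?invr_gt0 // ltr_wpDl.
move=> q /aff_sub qA; rewrite ltr_pdivlMr ?ltr_wpDl // => qs.
pose c := (q - (p0 + s)) *m M.
have cA : c *m A = q - (p0 + s).
  rewrite /c mulmxKpV // opprD addrA; apply: addmx_sub => //.
  by rewrite -scaleN1r scalemx_sub.
have cK i : `|c 0 i| <= K^-1 ^+ 2.
  apply: le_trans (ltW qs); rewrite mxE.
  apply: le_trans (ler_norm_sum _ _ _) _.
  apply: (@le_trans _ _ (\sum_j `|q - (p0 + s)| * `|M j i|)).
    apply: ler_sum => j _; rewrite normrM ler_wpM2r //; exact: coord_le_norm.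
  rewrite -mulr_sumr ler_wpM2l // (@le_trans _ _ B) ?lerDl //.
  by apply: ler_sum => j _; rewrite (bigD1 i) //= lerDl sumr_ge0.
have -> : q = p0 + \sum_i (K^-1 + c 0 i) *: row i A.
  under eq_bigr do rewrite scalerDl.
  by rewrite big_split /= -/s -sE cA addrA subrKC.
apply: convex_set_sum => // [i|].
  have := cK i; rewrite ler_norml => /andP[+ _].
  have : K^-1 ^+ 2 <= K^-1.
    by rewrite expr2 ler_piMl ?invr_ge0 ?(ltW K0) // invf_le1 // ler1n.
  by move: (c 0 i) (K^-1) => ci Ki h1 h2; lra.
rewrite big_split /= Ksum.
have : \sum_i c 0 i <= k%:R * K^-1 ^+ 2.
  rewrite mulr_natl -[X in _ *+ X]card_ord -sumr_const; apply: ler_sum => i _.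
  exact: le_trans (ler_norm _) (cK i).
move=> h; apply: le_trans (lerD (lexx _) h) _.
(* After multiplication by [K ^+ 2] the claim is [k * (k + 1) + k <= (k + 1) ^+ 2]. *)
rewrite -(ler_pM2r K0) -(ler_pM2r K0) mul1r.
have -> : (k%:R / K + k%:R * K^-1 ^+ 2) * K * K = k%:R * K + k%:R.
  by field; rewrite gt_eqF.
by rewrite -kK; have : (0 : R) <= k%:R by []; nra.
Qed.

(** The homothety with centre [x] and ratio [t^-1] sends the ball of radius [t * e] around the new
    point to the ball of radius [e] around [y]; convexity brings the image back into [X]. *)
Lemma rel_interior_segment (x y : V) (t : R) : X x -> rel_interior X y ->
  0 < t <= 1 -> rel_interior X (x + t *: (y - x)).
Proof.
move=> Xx [Xy [e e0 He]] /andP[t0 t1].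
have t00 : t != 0 by rewrite gt_eqF.
split; first by apply: convex_set_segment => //; rewrite ltW.
exists (t * e); first exact: mulr_gt0.
move=> q aq qe.
have Xz : X (x + t^-1 *: (q - x)).
  apply: He; first exact: affine_hull_segment.
  have -> : x + t^-1 *: (q - x) - y = t^-1 *: (q - (x + t *: (y - x))).
    rewrite opprD addrA [in RHS]scalerBr scalerA mulVf // scale1r.
    by rewrite opprB addrCA addrA.
  by rewrite normrZ gtr0_norm ?invr_gt0 // ltr_pdivrMl.
have := convex_set_segment cX Xx Xz => /(_ t).
rewrite ltW // t1 => /(_ isT).
by rewrite addrC [x + _ - x]addrC addKr scalerA divff // scale1r subrK.
Qed.

End RelativeInterior.

(** * Norms and dual norms *)

Section Norms.
Context {R : realType} {d : nat}.
Local Notation V := 'rV[R]_d.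

Lemma lipschitz_continuous (g : V -> R) (K : R) :
  (forall x y, g x - g y <= K * `|x - y|) -> continuous g.
Proof.
move=> gK x; apply/(@cvgrPdist_lt _ _ _ (nbhs x) (nbhs_filter x)) => e e0.
have K1 : 0 < `|K| + 1 by rewrite ltr_wpDl.
near=> y.
have xy : `|x - y| < e / (`|K| + 1).
  near: y; apply/nbhs_ballP; exists (e / (`|K| + 1)) => /=; first exact: divr_gt0.
  by move=> z; rewrite -ball_normE.
apply: (@le_lt_trans _ _ ((`|K| + 1) * `|x - y|)); last by rewrite mulrC -ltr_pdivlMr.
have h z : K * `|z| <= (`|K| + 1) * `|z|.
  by rewrite ler_wpM2r // (le_trans (ler_norm _)) // lerDl.
rewrite ler_norml lerNl opprB (le_trans (gK _ _)) ?(le_trans (gK _ _)) //.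
by rewrite distrC.
Unshelve. all: by end_near. Qed.

Variable nrm : V -> R.
Hypothesis Hn : is_norm nrm.

Lemma is_norm_triangle x y : nrm (x + y) <= nrm x + nrm y.
Proof. by case: Hn. Qed.

Lemma is_normZ (a : R) x : nrm (a *: x) = `|a| * nrm x.
Proof. by case: Hn. Qed.

Lemma is_norm0 : nrm 0 = 0.
Proof. by rewrite -(scale0r 0) is_normZ normr0 mul0r. Qed.

Lemma is_normN x : nrm (- x) = nrm x.
Proof. by rewrite -scaleN1r is_normZ normrN1 mul1r. Qed.

Lemma is_norm_ge0 x : 0 <= nrm x.
Proof.
have := is_norm_triangle x (- x); rewrite subrr is_norm0 is_normN; lra.
Qed.

Lemma is_norm_le : exists2 K : R, 0 <= K & forall x, nrm x <= K * `|x|.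
Proof.
exists (\sum_(j < d) nrm (delta_mx 0 j)); first by apply: sumr_ge0 => j _; exact: is_norm_ge0.
move=> x; rewrite {1}(row_sum_delta x) mulr_suml.
elim/big_ind2: _ => [|a b a' b' h h'|j _]; first by rewrite is_norm0.
  by apply: le_trans (is_norm_triangle _ _) (lerD _ _).
by rewrite is_normZ mulrC ler_wpM2l ?is_norm_ge0 // coord_le_norm.
Qed.

Lemma is_norm_continuous : continuous nrm.
Proof.
have [K _ nK] := is_norm_le; apply: (@lipschitz_continuous _ K) => x y.
apply: le_trans (nK _); rewrite lerBlDr -{1}(subrK y x); exact: is_norm_triangle.
Qed.

(** Equivalence of norms: by compactness [nrm] attains a positive minimum on the unit sphere of the
    sup norm. *)
Lemma is_norm_ge : exists2 c : R, 0 < c & forall x, `|x| <= c * nrm x.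
Proof.
pose B : set V := [set x | `|x| = 1].
(* The sphere is empty when [d] is 0; then 0 is the only vector and any positive constant serves. *)
have [[b Bb]|/set0P/negP/negPn/eqP B0] := pselect (B !=set0); last first.
  exists 1 => // x; have [->|x0] := eqVneq x 0; first by rewrite normr0 is_norm0 mulr0.
  have : B (`|x|^-1 *: x).
    by rewrite /B /= normrZ normfV normr_id mulVf // normr_eq0.
  by rewrite B0.
have cB : compact B.
  apply: bounded_closed_compact.
    exists 1; split; first exact: num_real.
    by move=> M M1 x Bx; rewrite /= Bx ltW.
  have -> : B = Num.norm @^-1` [set (1 : R)] by [].
  apply: closed_comp; last exact: closed_eq.
  by move=> x _; exact: norm_continuous.
have [|y /[!inE] By ymin] := @EVT_min_rV _ _ nrm B (ex_intro _ b Bb) cB.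
  by apply: continuous_subspaceT; exact: is_norm_continuous.
have y0 : 0 < nrm y.
  rewrite lt_neqAle is_norm_ge0 andbT eq_sym; apply/eqP => ny.
  have y0 : y = 0 by case: Hn => + _ _; apply.
  by move: By; rewrite /B /= y0 normr0 => /esym/eqP; rewrite oner_eq0.
exists (nrm y)^-1; first by rewrite invr_gt0.
move=> x; rewrite ler_pdivlMl //.
have [->|x0] := eqVneq x 0; first by rewrite normr0 is_norm0 mulr0.
have := ymin (`|x|^-1 *: x); rewrite inE /B /= normrZ normfV normr_id mulVf ?normr_eq0 //.
move=> /(_ erefl); rewrite is_normZ normfV normr_id ler_pdivlMl ?normr_gt0 //.
by rewrite mulrC.
Qed.

Let ball_sup_bound : exists2 c : R, 0 <= c & forall z u, nrm u <= 1 -> inner z u <= c * `|z|.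
Proof.
have [c c0 nc] := is_norm_ge; exists (d%:R * c); first by rewrite mulr_ge0 // ltW.
move=> z u u1; apply: le_trans (ler_norm _) _; apply: le_trans (norm_inner_le _ _) _.
rewrite mulrAC ler_wpM2r // ler_wpM2l //.
by apply: le_trans (nc u) _; rewrite ler_piMr // ltW.
Qed.

(** Boundedness, from the comparison of norms, is what gives the real-valued [sup] in [dual_norm]
    its meaning. *)
Lemma dual_norm_has_sup z : has_sup [set inner z u | u in [set u | nrm u <= 1]].
Proof.
split; first by exists (inner z 0), 0 => //=; rewrite is_norm0.
have [c c0 H] := ball_sup_bound.
by exists (c * `|z|) => _ [u u1 <-]; exact: H.
Qed.

Lemma inner_le_dual_norm z u : inner z u <= dual_norm nrm z * nrm u.
Proof.
have [nu|nu] := eqVneq (nrm u) 0.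
  have -> : u = 0 by case: Hn => + _ _; apply.
  by rewrite is_norm0 mulr0 inner0r.
have nu0 : 0 < nrm u by rewrite lt_neqAle eq_sym nu is_norm_ge0.
rewrite -ler_pdivrMr // mulrC -innerZr; apply: ub_le_sup.
  by have [] := dual_norm_has_sup z.
exists ((nrm u)^-1 *: u) => //=; rewrite is_normZ gtr0_norm ?invr_gt0 // mulVf //.
Qed.

Lemma norm_inner_le_dual_norm z u : `|inner z u| <= dual_norm nrm z * nrm u.
Proof.
rewrite ler_norml inner_le_dual_norm andbT lerNl -(is_normN u).
have -> : - inner z u = inner z (- u) by rewrite !(innerC z) innerNl.
exact: inner_le_dual_norm.
Qed.

Lemma dual_norm_ge0 z : 0 <= dual_norm nrm z.
Proof.
apply: ub_le_sup; first by have [] := dual_norm_has_sup z.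
exists 0; first by rewrite /= is_norm0.
exact: inner0r.
Qed.

Lemma dual_norm_continuous : continuous (dual_norm nrm).
Proof.
have [c c0 H] := ball_sup_bound; apply: (@lipschitz_continuous _ c) => x y.
rewrite lerBlDr; apply: ge_sup.
  by exists (inner x 0), 0 => //=; rewrite is_norm0.
move=> _ [u u1 <-]; rewrite -{1}(subrK y x) innerDl lerD ?H //.
apply: ub_le_sup; first by have [] := dual_norm_has_sup y.
by exists u.
Qed.

End Norms.

(** * Measurable selections *)

Section CountableSelection.
Context {dT} {T : measurableType dT} {R : realType}.

(** The selection is the first admissible index. Its measurability is stated through families [K],
    because it serves to evaluate such families at [s t]; on each piece of the partition a single
    [K k] occurs. *)
Lemma measurable_selection (G : nat -> set T) :
  (forall k, measurable (G k)) -> (forall t, exists k, G k t) ->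
  exists2 s : T -> nat, (forall t, G (s t) t) &
    forall K : nat -> T -> R, (forall k, measurable_fun setT (K k)) ->
      measurable_fun setT (fun t => K (s t) t).
Proof.
move=> mG coverG.
have /choice[s sP] t : exists k, seqDU G k t.
  have [k Gk] := coverG t.
  have : (\bigcup_k seqDU G k) t by rewrite -seqDU_bigcup_eq; exists k.
  by move=> [n _ Hn]; exists n.
exists s => [t|K mK]; first exact: subset_seqDU (sP t).
have sE k : s @^-1` [set k] = seqDU G k.
  apply/seteqP; split=> t /=; first by move=> <-.
  move=> Hk; have /trivIsetP/(_ k (s t) I I) := trivIset_seqDU G.
  have [-> //|_ /(_ isT)] := eqVneq k (s t).
  by move=> /seteqP[/(_ t) + _] => /(_ (conj Hk (sP t))).
have ms k : measurable (s @^-1` [set k]).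
  rewrite sE /seqDU; apply: measurableD => //.
  by apply: bigsetU_measurable => i _.
move=> _ B mB; rewrite setTI.
rewrite (_ : _ @^-1` B = \bigcup_k (s @^-1` [set k] `&` (setT `&` K k @^-1` B))).
  by apply: bigcup_measurable => k _; apply: measurableI => //; exact: mK.
apply/seteqP; split=> t /=; first by move=> Bt; exists (s t).
by move=> [k _ [/= -> [_ ?]]].
Qed.

End CountableSelection.

(** * Rational approximation and measurable maps into the vector space *)

Section VectorMeasurability.
Context {R : realType} {d : nat}.
Local Notation V := 'rV[R]_d.

Lemma rat_approx (x e : R) : 0 < e -> exists q : rat, `|x - ratr q| < e.
Proof.
move=> e0; have [q] : exists q, ratr q \in `]x - e, x + e[.
  by apply: rat_in_itvoo; lra.
rewrite in_itv /= => /andP[h1 h2]; exists q; rewrite ltr_norml; lra.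
Qed.

Lemma rat_vec_approx (x : V) (e : R) : 0 < e ->
  exists q : 'rV[rat]_d, `|x - map_mx ratr q| < e.
Proof.
move=> e0; have e2 : 0 < e / 2 by rewrite divr_gt0.
have /choice[q qP] j := rat_approx (x 0 j) e2.
exists (\row_j q j); apply: (@le_lt_trans _ _ (e / 2)); last by lra.
by apply: norm_le_coord => [|j]; [exact: ltW|rewrite !mxE ltW].
Qed.

(* Density in the graph of [h], because [h] is not assumed continuous on [A]. *)
Lemma dense_graph_sequence (A : set V) (h : V -> R) : A !=set0 ->
  exists2 D : nat -> V, (forall k, A (D k)) &
    forall y, A y -> forall e : R, 0 < e ->
      exists k, `|D k - y| < e /\ `|h (D k) - h y| < e.
Proof.
move=> [a0 Aa0].
(* An index consists of a rational point, a rational value and a precision; [g] picks a point of [A]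
   matching all three whenever there is one. *)
pose near (i : 'rV[rat]_d * rat * nat) y :=
  `|y - map_mx ratr i.1.1| < i.2.+1%:R^-1 /\ `|h y - ratr i.1.2| < i.2.+1%:R^-1.
have /choice[g gP] i : exists y, A y /\ ((exists2 z, A z & near i z) -> near i y).
  have [[z Az zi]|nz] := pselect (exists2 z, A z & near i z); first by exists z.
  by exists a0; split=> // /nz.
exists (fun k => if unpickle k is Some i then g i else a0).
  by move=> k; case: unpickle => // i; have [] := gP i.
move=> y Ay e e0.
have [n ne] : exists n, 2 * n.+1%:R^-1 < e :> R.
  have e2 : 0 < e / 2 by rewrite divr_gt0.
  have [n _ /(_ n (leqnn n)) /= Hn] := near_infty_natSinv_lt (PosNum e2).
  by exists n; move: Hn => /=; set x := _^-1; lra.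
have n0 : 0 < n.+1%:R^-1 :> R by rewrite invr_gt0.
have [q qP] := rat_vec_approx y n0; have [c cP] := rat_approx (h y) n0.
exists (pickle (q, c, n)); rewrite pickleK.
have [_ /(_ _)[|/= g1 g2]] := gP (q, c, n); first by exists y.
set z := g _ in g1 g2 *.
split.
  apply: le_lt_trans ne; rewrite -(subrKA (map_mx ratr q)).
  apply: le_trans (ler_normD _ _) _.
  by rewrite [`|_ - y|]distrC mulr_natl mulr2n lerD // ltW.
apply: le_lt_trans ne; rewrite -(subrKA (ratr c)).
apply: le_trans (ler_normD _ _) _.
by rewrite [`|_ - h y|]distrC mulr_natl mulr2n lerD // ltW.
Qed.

Context {dT} {T : measurableType dT}.

(** Coordinatewise, so that no sigma-algebra on [V] has to be fixed. *)
Definition vmeasurable (g : T -> V) :=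
  forall j, measurable_fun setT (fun t => g t 0 j).

Lemma measurable_inner (g1 g2 : T -> V) : vmeasurable g1 -> vmeasurable g2 ->
  measurable_fun setT (fun t => inner (g1 t) (g2 t)).
Proof.
by move=> m1 m2; apply: measurable_sum => j; apply: measurable_funM.
Qed.

(** Since [c] takes countably many values, [K (c t) t] is measurable as soon as every [K q] is,
    however [K] depends on [q]. *)
Lemma measurable_rounding (g : T -> V) (e : R) : 0 < e -> vmeasurable g ->
  exists2 c : T -> V, (forall t, `|c t - g t| <= e) &
    forall K : V -> T -> R, (forall q, measurable_fun setT (K q)) ->
      measurable_fun setT (fun t => K (c t) t).
Proof.
move=> e0 mg.
pose q k : V := if unpickle k is Some q' then map_mx ratr (q' : 'rV[rat]_d) else 0.
pose G k := [set t | forall j, `|g t 0 j - q k 0 j| <= e].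
have mG k : measurable (G k).
  have -> : G k = \bigcap_(j in [set: 'I_d]) [set t | `|g t 0 j - q k 0 j| <= e].
    by apply/seteqP; split=> t /= H j; [move=> _; exact: H|exact: H].
  apply: fin_bigcap_measurable => // j _.
  rewrite -[X in measurable X]setTI; apply: measurable_fun_le => //.
  by apply: measurableT_comp => //; exact: measurable_funB.
have [|s sP sK] := measurable_selection (R := R) mG.
  move=> t; have [p pP] := rat_vec_approx (g t) e0.
  exists (pickle p) => j; rewrite /q pickleK.
  by have := coord_le_norm (g t - map_mx ratr p) j; rewrite !mxE; lra.
exists (q \o s) => [t|K mK]; last exact: (sK (fun k => K (q k))).
apply: norm_le_coord => [|j]; first exact: ltW.
by rewrite !mxE distrC; exact: sP.
Qed.

(** A limit of [h] along ever finer roundings of [g]. Continuity is asked only at the values of [g],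
    which fits [dw] on [S]. *)
Lemma measurable_continuous_comp (h : V -> R) (g : T -> V) : vmeasurable g ->
  (forall t, {for g t, continuous h}) -> measurable_fun setT (fun t => h (g t)).
Proof.
move=> mg ch.
have /choice[c cP] n : exists c : T -> V, (forall t, `|c t - g t| <= n.+1%:R^-1) /\
    measurable_fun setT (fun t => h (c t)).
  have n0 : 0 < n.+1%:R^-1 :> R by rewrite invr_gt0.
  have [c c1 c2] := measurable_rounding n0 mg.
  by exists c; split=> //; apply: (c2 (fun q _ => h q)).
apply: (@measurable_fun_cvg _ _ _ _ (fun n t => h (c n t))); first by move=> n; case: (cP n).
move=> t _; apply: (@cvg_comp _ _ _ (fun n => c n t) h \oo (nbhs (g t))); last exact: ch.
apply/cvgrPdist_le => e e0; have [N _ HN] := near_infty_natSinv_lt (PosNum e0).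
exists N => // n Nn; rewrite distrC; have [/(_ t) H _] := cP n.
by apply: le_trans H _; apply/ltW/HN.
Qed.

(* Off [X] nothing is known about the regularity of [f ^~ z].  Differentiability
   at [g t] alone lets one replace [g t] by a point within [1/N^2] of it, taken in
   a countable set, in the difference quotient of step [1/N]. *)
Lemma vmeasurable_gradient_comp {dX} {Xi : measurableType dX} (X : set V)
  (f : V -> Xi -> R) (gf : V -> Xi -> V) (g : T -> V) (xi : T -> Xi) :
  (forall x, measurable_fun setT (f x)) ->
  (forall z, is_gradient_on X (f ^~ z) (gf ^~ z)) ->
  vmeasurable g -> (forall t, X (g t)) -> measurable_fun setT xi ->
  vmeasurable (fun t => gf (g t) (xi t)).
Proof.
move=> mf gradf mg Xg mxi j.
pose N n : R := n.+1%:R.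
have N0 n : 0 < N n by rewrite ltr0n.
pose K n (q : V) t := N n * (f (q + (N n)^-1 *: delta_mx 0 j) (xi t) - f q (xi t)).
have mK n q : measurable_fun setT (K n q).
  apply: measurable_funM => //; apply: measurable_funB; exact: measurableT_comp.
have /choice[c cP] n : exists c : T -> V, (forall t, `|c t - g t| <= (N n)^-1 ^+ 2) /\
    measurable_fun setT (fun t => K n (c t) t).
  have n0 : 0 < (N n)^-1 ^+ 2 by rewrite exprn_gt0 ?invr_gt0.
  have [c c1 c2] := measurable_rounding n0 mg.
  by exists c; split=> //; apply: c2.
apply: (@measurable_fun_cvg _ _ _ _ (fun n t => K n (c n t) t)); 
  first by move=> n; case: (cP n).
move=> t _; apply/cvgrPdist_le => e e0.
(* With [i] the step of the quotient, its two points lie within [2 * i] and [i] of [g t], so the two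
   expansion errors add up to at most [e * i]. *)
have e3 : 0 < e / 3 by rewrite divr_gt0.
have [dl dl0 Hdl] := gradient_expansion (gradf (xi t)) (Xg t) e3.
have dl2 : 0 < dl / 2 by rewrite divr_gt0.
have [M _ HM] := near_infty_natSinv_lt (PosNum dl2).
exists M => // n Mn; have HNdl := HM n Mn.
have [/(_ t) cg _] := cP n.
set x := g t in cg Hdl *; set q := c n t in cg *; set i := (N n)^-1 in cg *.
have i0 : 0 < i by rewrite invr_gt0.
have i1 : i <= 1 by rewrite invf_le1 // ler1n.
have ii : i ^+ 2 <= i by rewrite expr2 ler_piMl // ltW.
pose h1 := q + i *: delta_mx 0 j - x; pose h2 := q - x.
have nd : `|delta_mx 0 j : V| <= 1.
  by apply: norm_le_coord => // k; rewrite !mxE; case: (_ && _); rewrite ?normr1 ?normr0.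
have n1 : `|h1| <= 2 * i.
  rewrite /h1 addrAC; apply: le_trans (ler_normD _ _) _.
  rewrite mulr_natl mulr2n lerD // ?(le_trans cg) // normrZ gtr0_norm //.
  by rewrite ler_piMr // ltW.
have n2 : `|h2| <= i by exact: le_trans cg ii.
have idl : i < dl / 2 by exact: HNdl.
have /Hdl : `|h2| < dl by apply: le_lt_trans n2 _; lra.
have /Hdl : `|h1| < dl by apply: le_lt_trans n1 _; lra.
rewrite !(addrC x) !subrK => E1 E2.
have dE : inner (gf x (xi t)) h1 - inner (gf x (xi t)) h2 = i * gf x (xi t) 0 j.
  rewrite -innerBr /h1 /h2 opprB addrA subrK addrC addKr innerZr; congr (_ * _).
  rewrite /inner (bigD1 j) //= mxE !eqxx mulr1 big1 ?addr0 // => k kj.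
  by rewrite mxE (negPf kj) andbF mulr0.
have Ni : N n = i^-1 by rewrite /i invrK.
rewrite /K Ni invrK -(ler_pM2l i0) -{1}(gtr0_norm i0) -normrM mulrBr -dE mulVKf ?gt_eqF //.
have := le_trans E1 (ler_wpM2l (ltW e3) n1); have := le_trans E2 (ler_wpM2l (ltW e3) n2).
rewrite !ler_norml => /andP[a1 a2] /andP[b1 b2]; apply/andP; split; lra.
Qed.

(** The parameter [t] enters through a linear functional only, so one sequence dense in the graph of
    [h] approximates the infimum for every [t]. Half of [e] pays for choosing an index, half for the
    density. *)
Lemma measurable_near_minimizer (A : set V) (h : V -> R) (p : T -> V) (e : R) :
  A !=set0 -> 0 < e -> vmeasurable p ->
  (forall t, exists m, forall y, A y -> m <= h y + inner (p t) y) ->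
  exists u : T -> V, [/\ forall t, A (u t),
    forall t y, A y -> h (u t) + inner (p t) (u t) <= h y + inner (p t) y + e &
    forall K : V -> T -> R, (forall q, measurable_fun setT (K q)) ->
      measurable_fun setT (fun t => K (u t) t)].
Proof.
move=> A0 e0 mp hlb; have [D AD dD] := dense_graph_sequence h A0.
have e2 : 0 < e / 2 by rewrite divr_gt0.
pose obj t y := h y + inner (p t) y.
pose G k := [set t | forall i, obj t (D k) <= obj t (D i) + e / 2].
have mobj y : measurable_fun setT (obj ^~ y).
  by apply: measurable_funD => //; apply: measurable_inner => // j.
have mG k : measurable (G k).
  have -> : G k = \bigcap_i [set t | obj t (D k) <= obj t (D i) + e / 2].
    by apply/seteqP; split=> t /= H i; [move=> _; exact: H|exact: H].
  apply: bigcap_measurableType => i _.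
  rewrite -[X in measurable X]setTI; apply: measurable_fun_le => //.
  exact: measurable_funD.
have [|s sP sK] := measurable_selection (R := R) mG.
  move=> t; have [m mP] := hlb t.
  have hi : has_inf [set obj t (D k) | k in setT].
    split; first by exists (obj t (D 0%N)), 0%N.
    by exists m => _ [k _ <-]; exact: mP.
  have [_ [k _ <-] Hk] := inf_adherent e2 hi.
  exists k => i; apply: le_trans (ltW Hk) _; rewrite lerD2r.
  by apply: ge_inf; [case: hi|exists i].
exists (D \o s); split=> [t|t y Ay|K mK]; first exact: AD.
  pose c := d%:R * `|p t| + 2.
  have c0 : 0 < c by rewrite ltr_wpDl // mulr_ge0.
  have ec : 0 < e / 2 / c by rewrite divr_gt0.
  have [k [k1 k2]] := dD y Ay _ ec.
  have := sP t k; rewrite /obj /=.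
  have : h (D k) + inner (p t) (D k) <= h y + inner (p t) y + e / 2.
    have : inner (p t) (D k - y) <= d%:R * `|p t| * (e / 2 / c).
      apply: le_trans (ler_norm _) _; apply: le_trans (norm_inner_le _ _) _.
      by rewrite ler_wpM2l ?mulr_ge0 // ltW.
    rewrite innerBr; have : h (D k) - h y <= 2 * (e / 2 / c).
      by apply: le_trans (ler_norm _) _; lra.
    have : e / 2 = d%:R * `|p t| * (e / 2 / c) + 2 * (e / 2 / c).
      by rewrite -mulrDl [RHS]mulrC divfK // gt_eqF.
    by move: (e / 2 / c) => ec1; lra.
  lra.
exact: (sK (fun k => K (D k))).
Qed.

(* The quadratic growth forces minimisers up to [1/n], which can be chosen
   measurably, to converge to [y]. *)
Lemma vmeasurable_minimizer (A : set V) (h : V -> R) (p y : T -> V) (c : R) :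
  0 < c -> vmeasurable p -> (forall t, A (y t)) ->
  (forall t z, A z -> h (y t) + inner (p t) (y t) + c * `|z - y t| ^+ 2 <=
    h z + inner (p t) z) -> vmeasurable y.
Proof.
move=> c0 mp Ay ymin j.
have [[t0 _]|T0] := pselect ([set: T] !=set0); last first.
  move=> _ B _; rewrite (_ : _ `&` _ = set0) //.
  by apply/seteqP; split=> t // _; apply: T0; exists t.
have A0 : A !=set0 by exists (y t0).
have hlb t : exists m, forall z, A z -> m <= h z + inner (p t) z.
  exists (h (y t) + inner (p t) (y t)) => z /(ymin t); apply: le_trans.
  by rewrite lerDl mulr_ge0 ?exprn_ge0 // ltW.
have /choice[u uP] n : exists u : T -> V, (forall t, c * `|u t - y t| ^+ 2 <= n.+1%:R^-1) /\
    measurable_fun setT (fun t => u t 0 j).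
  have n0 : 0 < n.+1%:R^-1 :> R by rewrite invr_gt0.
  have [u [Au umin uK]] := measurable_near_minimizer A0 n0 mp hlb.
  exists u; split; last exact: (uK (fun q _ => q 0 j)).
  move=> t; have := umin t _ (Ay t); have := ymin t _ (Au t).
  by move: (_^-1) (c * _) (h _ + _) (h _ + _) => i1 i2 i3 i4; lra.
apply: (@measurable_fun_cvg _ _ _ _ (fun n t => u n t 0 j)); first by move=> n; case: (uP n).
move=> t _; apply/cvgrPdist_le => e e0.
have ce : 0 < c * e ^+ 2 by rewrite mulr_gt0 // exprn_gt0.
have [N _ HN] := near_infty_natSinv_lt (PosNum ce).
exists N => // n Nn; have [/(_ t) H _] := uP n.
have := le_trans H (ltW (HN n Nn)); rewrite /= ler_pM2l // ler_sqr ?nnegrE // ?(ltW e0) //.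
move=> ue; have := coord_le_norm (u n t - y t) j.
by rewrite !mxE distrC => /le_trans; apply.
Qed.

End VectorMeasurability.

(** * Sub-Gaussian moments *)

Section MomentGenerating.
Context {R : realType}.

(** The inequality [1 - y <= expR (- y)] at [y = x / n.+1%:R], inverted and raised to the power
    [n.+1]. *)
Lemma expR_le_inv (x : R) (n : nat) : x < n.+1%:R ->
  expR x <= (1 - x / n.+1%:R) ^- n.+1.
Proof.
move=> xn; have n0 : 0 < n.+1%:R :> R by rewrite ltr0n.
have h : 0 < 1 - x / n.+1%:R by rewrite subr_gt0 ltr_pdivrMr // mul1r.
rewrite -[X in expR X](divfK (lt0r_neq0 n0)) [X in expR X]mulrC expRM_natl.
rewrite -exprVn ler_pXn2r ?nnegrE ?expR_ge0 ?invr_ge0 ?(ltW h) //.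
rewrite -[leLHS]invrK -expRN lef_pV2 ?posrE ?expR_gt0 //.
exact: expR_ge1Dx.
Qed.

(** For a centred variable the linear term integrates to 0 and only the square is left. Below 1,
    [expR x] is bounded by a rational function and [expR (x ^+ 2)] by a polynomial. *)
Lemma expR_le_addsqr (x : R) : expR x <= x + expR (x ^+ 2).
Proof.
have [x1|x1] := leP 1 x.
  have h : expR x <= expR (x ^+ 2) by rewrite ler_expR expr2 ler_peMl // (le_trans ler01).
  by apply: le_trans h _; rewrite lerDr (le_trans ler01).
have [x0|x0] := leP 0 x.
  have h4 : 0 < (1 - x / 4) ^+ 4 by rewrite exprn_gt0 //; lra.
  have /le_trans : expR x <= (1 - x / 4) ^- 4 by apply: expR_le_inv; lra.
  apply; rewrite -[leLHS]mul1r ler_pdivrMr //.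
  have h : (1 + x ^+ 2 / 2) ^+ 2 <= expR (x ^+ 2).
    rewrite -[X in expR X](@divfK _ 2) // [X in expR X]mulrC expRM_natl.
    rewrite ler_pXn2r ?nnegrE ?expR_ge0 ?expR_ge1Dx //.
    by have := sqr_ge0 x; lra.
  have {h} := ler_wpM2r (ltW h4) (lerD (lexx x) h); apply: le_trans.
  have y0 : 0 <= 1 - x by lra.
  rewrite -subr_ge0.
  (* The second factor is expanded in powers of [1 - x], where all its coefficients are positive. *)
  have -> : (x + (1 + x ^+ 2 / 2) ^+ 2) * (1 - x / 4) ^+ 4 - 1 =
      (x / 32) ^+ 2 * (29 + 166 * (1 - x) + 87 * (1 - x) ^+ 2 + 56 * (1 - x) ^+ 3
      + 35 * (1 - x) ^+ 4 + 10 * (1 - x) ^+ 5 + (1 - x) ^+ 6).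
    by field.
  rewrite mulr_ge0 ?sqr_ge0 //.
  have h k : 0 <= (1 - x) ^+ k by rewrite exprn_ge0.
  by move: (h 2%N) (h 3%N) (h 4%N) (h 5%N) (h 6%N); lra.
have h2 : 0 < (1 - x / 2) ^+ 2 by rewrite exprn_gt0 //; lra.
have /le_trans : expR x <= (1 - x / 2) ^- 2 by apply: expR_le_inv; lra.
apply; rewrite -[leLHS]mul1r ler_pdivrMr //.
have := ler_wpM2r (ltW h2) (lerD (lexx x) (expR_ge1Dx (x ^+ 2))); apply: le_trans.
rewrite -subr_ge0.
have -> : (x + (1 + x ^+ 2)) * (1 - x / 2) ^+ 2 - 1 = x ^+ 2 / 4 * (1 - 3 * x + x ^+ 2).
  by field.
by rewrite mulr_ge0 ?divr_ge0 ?sqr_ge0 // addr_ge0 ?sqr_ge0 //; lra.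
Qed.

Context {dX} {Xi : measurableType dX} (P : probability Xi R).
Variables (n : Xi -> R) (sigma : R).
Hypotheses (mn : measurable_fun setT n) (n0 : forall z, 0 <= n z).
Hypotheses (sigma0 : 0 < sigma) (subg : sub_gaussian P n sigma).

Lemma sub_gaussian_sqr (c : R) : 0 <= c -> c <= sigma ^- 2 ->
  (\int[P]_z (expR (c * n z ^+ 2))%:E <= (expR (c * sigma ^+ 2))%:E)%E.
Proof.
move=> c0 cs; rewrite -(sqr_sqrtr c0); apply: subg.
rewrite ger0_norm ?sqrtr_ge0 // -ler_sqr ?nnegrE ?sqrtr_ge0 ?invr_ge0 ?(ltW sigma0) //.
by rewrite sqr_sqrtr // exprVn.
Qed.

Lemma sub_gaussian_mgf (s : Xi -> R) (B : R) : 0 <= B ->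
  P.-integrable setT (EFin \o s) -> (\int[P]_z (s z)%:E = 0)%E ->
  (forall z, `|s z| <= n z * B) ->
  (\int[P]_z (expR (s z))%:E <= (expR (B ^+ 2 * sigma ^+ 2))%:E)%E.
Proof.
move=> B0 si s0 sB.
have ms : measurable_fun setT s by apply/measurable_EFinP; case/integrableP: si.
have mexp (c : R) : measurable_fun setT (fun z => (expR (c * n z ^+ 2))%:E).
  apply/measurable_EFinP; apply: measurableT_comp => //.
  by apply: measurable_funM => //; exact: measurable_funX.
have mexps : measurable_fun setT (fun z => (expR (s z))%:E).
  by apply/measurable_EFinP; exact: measurableT_comp.
have s20 : 0 < sigma ^+ 2 by rewrite exprn_gt0.
have [Bs|Bs] := leP (B ^+ 2 * sigma ^+ 2) 1.
  have Bc : B ^+ 2 <= sigma ^- 2 by rewrite -[leRHS]mul1r ler_pdivlMr.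
  have bnd := sub_gaussian_sqr (sqr_ge0 B) Bc.
  apply: (@le_trans _ _ (\int[P]_z ((s z)%:E + (expR (B ^+ 2 * n z ^+ 2))%:E))%E).
    apply: ge0_le_integral => //.
    - by apply: emeasurable_funD => //; apply/measurable_EFinP.
    move=> z _; rewrite -EFinD lee_fin; apply: le_trans (expR_le_addsqr _) _.
    rewrite lerD2l ler_expR -exprMn mulrC -real_normK ?num_real //.
    by rewrite ler_pXn2r ?nnegrE ?mulr_ge0.
  rewrite integralD //; last first.
    apply/integrableP; split=> //.
    rewrite (eq_integral (fun z => (expR (B ^+ 2 * n z ^+ 2))%:E)).
      exact: le_lt_trans bnd (ltry _).
    by move=> z _; rewrite gee0_abs // lee_fin expR_ge0.
  by rewrite s0 add0e.
(* Here [B ^+ 2 * sigma ^+ 2] exceeds 1. Young's inequality bounds [s z] by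
   [C + sigma ^- 2 / 2 * n z ^+ 2]; the second term contributes 1/2 to the exponent, which is at
   most [C]. *)
have hc0 : 0 <= (sigma ^- 2) / 2 by rewrite divr_ge0 // invr_ge0 ltW.
have hc1 : (sigma ^- 2) / 2 <= sigma ^- 2.
  by rewrite ler_pdivrMr // ler_peMr ?invr_ge0 ?(ltW s20) // ler1n.
have bnd := sub_gaussian_sqr hc0 hc1.
pose C := B ^+ 2 * sigma ^+ 2 / 2.
apply: (@le_trans _ _ (\int[P]_z ((expR C)%:E * (expR (sigma ^- 2 / 2 * n z ^+ 2))%:E))%E).
  apply: ge0_le_integral => //.
  - by apply: emeasurable_funM.
  move=> z _; rewrite -EFinM lee_fin -expRD ler_expR.
  apply: le_trans (ler_norm _) _; apply: le_trans (sB z) _; rewrite /C -subr_ge0.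
  have -> : B ^+ 2 * sigma ^+ 2 / 2 + sigma ^- 2 / 2 * n z ^+ 2 - n z * B =
      (B * sigma - n z / sigma) ^+ 2 / 2 by field; rewrite gt_eqF.
  by rewrite divr_ge0 ?sqr_ge0.
rewrite ge0_integralZl //.
apply: (le_trans (lee_wpmul2l _ bnd)); first by rewrite lee_fin expR_ge0.
rewrite -EFinM lee_fin -expRD ler_expR /C.
have -> : sigma ^- 2 / 2 * sigma ^+ 2 = 1 / 2 by field; rewrite gt_eqF.
lra.
Qed.

(* Convexity of [expR] with weights 2/5 and 3/5 separates the two terms; these
   weights keep the linear part below [3 B^2 sigma^2], as (5/3)^2 <= 3. *)
Lemma sub_gaussian_step (s : Xi -> R) (a B : R) : 0 <= B -> 0 <= a ->
  5 / 2 * a <= sigma ^- 2 ->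
  P.-integrable setT (EFin \o s) -> (\int[P]_z (s z)%:E = 0)%E ->
  (forall z, `|s z| <= n z * B) ->
  (\int[P]_z (expR (a * n z ^+ 2 + s z))%:E <=
    (expR (5 / 2 * a * sigma ^+ 2 + 3 * B ^+ 2 * sigma ^+ 2))%:E)%E.
Proof.
move=> B0 a0 a1 si s0 sB.
have ms : measurable_fun setT s by apply/measurable_EFinP; case/integrableP: si.
pose s' z := 5 / 3 * s z.
have s'i : P.-integrable setT (EFin \o s').
  have -> : EFin \o s' = (fun z => (5 / 3)%:E * (s z)%:E)%E by apply/funext => z; rewrite -EFinM.
  exact: integrableZl.
have s'0 : (\int[P]_z (s' z)%:E = 0)%E.
  under eq_integral do rewrite EFinM.
  by rewrite integralZl // s0 mule0.
have s'B z : `|s' z| <= n z * (5 / 3 * B).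
  rewrite normrM ger0_norm ?divr_ge0 // mulrCA ler_wpM2l ?divr_ge0 //.
have B'0 : 0 <= 5 / 3 * B by rewrite mulr_ge0 // divr_ge0.
have a'0 : 0 <= 5 / 2 * a by rewrite mulr_ge0 // divr_ge0.
have b1 := sub_gaussian_mgf B'0 s'i s'0 s'B.
have b2 := sub_gaussian_sqr a'0 a1.
set E := expR _.
pose g1 z := (2 / 5 * expR (5 / 2 * a * n z ^+ 2))%:E.
pose g2 z := (3 / 5 * expR (s' z))%:E.
have mq c : measurable_fun setT (fun z => expR (c * n z ^+ 2)).
  apply: measurableT_comp => //.
  by apply: measurable_funM => //; exact: measurable_funX.
have ms' : measurable_fun setT s' by apply: measurable_funM.
have mg1 : measurable_fun setT g1 by apply/measurable_EFinP/measurable_funM.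
have mg2 : measurable_fun setT g2.
  by apply/measurable_EFinP/measurable_funM => //; exact: measurableT_comp.
have g10 z : (0 <= g1 z)%E by rewrite lee_fin mulr_ge0 ?expR_ge0 // divr_ge0.
have g20 z : (0 <= g2 z)%E by rewrite lee_fin mulr_ge0 ?expR_ge0 // divr_ge0.
apply: (@le_trans _ _ (\int[P]_z (g1 z + g2 z))%E).
  apply: ge0_le_integral => //.
  - apply/measurable_EFinP/measurableT_comp => //; apply: measurable_funD => //.
    by apply: measurable_funM => //; exact: measurable_funX.
  - exact: emeasurable_funD.
  move=> z _; rewrite -EFinD lee_fin.
  have p0 : 0 <= 2 / 5 :> R by rewrite divr_ge0.
  have p1 : 2 / 5 <= 1 :> R by lra.
  have := convex_expR (Itv01 p0 p1) (5 / 2 * a * n z ^+ 2) (s' z).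
  rewrite !convRE /= /unstable.onem => H.
  have -> : a * n z ^+ 2 + s z = 2 / 5 * (5 / 2 * a * n z ^+ 2) + (1 - 2 / 5) * s' z.
    by rewrite /s'; field.
  apply: le_trans H _; rewrite lerD2l ler_wpM2r ?expR_ge0 //; lra.
rewrite ge0_integralD //.
rewrite /g1 /g2; under eq_integral do rewrite EFinM.
under [X in (_ + X)%E]eq_integral do rewrite EFinM.
have c1 : (0 <= (2 / 5)%:E :> \bar R)%E by rewrite lee_fin divr_ge0.
have c2 : (0 <= (3 / 5)%:E :> \bar R)%E by rewrite lee_fin divr_ge0.
have mq1 : measurable_fun setT (fun z => (expR (5 / 2 * a * n z ^+ 2))%:E).
  exact/measurable_EFinP.
have ms1 : measurable_fun setT (fun z => (expR (s' z))%:E).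
  by apply/measurable_EFinP; exact: measurableT_comp.
rewrite !ge0_integralZl //.
apply: (@le_trans _ _ ((2 / 5)%:E * E%:E + (3 / 5)%:E * E%:E)%E).
  apply: leeD; apply: lee_wpmul2l => //.
    apply: le_trans b2 _; rewrite lee_fin ler_expR lerDl.
    by rewrite mulr_ge0 ?sqr_ge0 // mulr_ge0 ?sqr_ge0.
  apply: le_trans b1 _; rewrite lee_fin ler_expR -[leLHS]add0r lerD //.
    by rewrite mulr_ge0 ?sqr_ge0.
  rewrite ler_wpM2r ?sqr_ge0 // exprMn ler_wpM2r ?sqr_ge0 //; lra.
by rewrite -!EFinM -EFinD lee_fin; lra.
Qed.

End MomentGenerating.

(** * Independence of the past *)

Section Freezing.
Local Open Scope ereal_scope.
Context {R : realType} {dO dQ dX} {O : measurableType dO} {Q : measurableType dQ}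
  {Xi : measurableType dX}.
Variables (P0 : probability O R) (P : probability Xi R) (pi : O -> Q) (xi : O -> Xi).
Hypotheses (mpi : measurable_fun setT pi) (mxi : measurable_fun setT xi).
Hypothesis indep : forall A B, measurable A -> measurable B ->
  P0 (pi @^-1` A `&` xi @^-1` B) = P0 (pi @^-1` A) * P B.

Let pi_mixin := isMeasurableFun.Build _ _ _ _ _ mpi.
Let pi_pack : {mfun O >-> Q} := HB.pack pi pi_mixin.
Let joint o := (pi o, xi o).
Let mjoint : measurable_fun setT joint.
Proof. exact: measurable_fun_pair. Qed.
Let joint_mixin := isMeasurableFun.Build _ _ _ _ _ mjoint.
Let joint_pack : {mfun O >-> (Q * Xi)%type} := HB.pack joint joint_mixin.

(* The law of [(pi, xi)] is the product of the law of [pi] with [P]. *)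
Lemma integral_freezing (U : Q * Xi -> \bar R) :
  measurable_fun setT U -> (forall z, 0 <= U z) ->
  \int[P0]_o U (pi o, xi o) = \int[P0]_o \int[P]_z U (pi o, z).
Proof.
move=> mU U0.
have -> : \int[P0]_o U (pi o, xi o) = \int[distribution P0 joint_pack]_z U z.
  by rewrite ge0_integral_pushforward // => z _.
rewrite (eq_measure_integral (distribution P0 pi_pack \x P)) => [|A mA _]; last first.
  by apply/esym/product_measure_unique.
rewrite fubini_tonelli1 // /fubini_F.
rewrite ge0_integral_pushforward //; first exact: measurable_fun_fubini_tonelli_F.
by move=> z _; apply: integral_ge0.
Qed.

End Freezing.

Section History.
Context {R : realType} {dO dX} {O : measurableType dO} {Xi : measurableType dX}.
Variables (P0 : probability O R) (xi : nat -> O -> Xi) (P : probability Xi R).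
Hypothesis iid : iid_seq P0 xi P.

(** A pi-system generating the sigma-algebra of the samples with index below [t]; [history t] is [O]
    with this coarser sigma-algebra. *)
Definition cylinders (t : nat) : set (set O) :=
  [set B | exists2 A : nat -> set Xi, forall i, measurable (A i) &
     B = \bigcap_(i in [set` iota 0 t]) (xi i @^-1` A i)].

Notation history t := (g_sigma_algebraType (cylinders t)).

Lemma cylinders_setI t : setI_closed (cylinders t).
Proof.
move=> _ _ [A mA ->] [B mB ->]; exists (fun i => A i `&` B i).
  by move=> i; exact: measurableI.
by rewrite -bigcapI.
Qed.

Lemma measurable_preimage_sample i (A : set Xi) : measurable A -> measurable (xi i @^-1` A).
Proof. by move=> mA; case: iid => mxi _ _; rewrite -[X in measurable X]setTI; exact: mxi. Qed.

Lemma cylinders_measurable t B : cylinders t B -> measurable B.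
Proof.
move=> [A mA ->]; apply: bigcap_measurableType => i _; exact: measurable_preimage_sample.
Qed.

Lemma measurable_to_history t : measurable_fun setT (id : O -> history t).
Proof.
move=> _ B mB; rewrite setTI preimage_id.
by apply: (smallest_sub _ _ mB) => [|A /cylinders_measurable //]; exact: sigma_algebra_measurable.
Qed.

Lemma measurable_sample_history t i : (i < t)%N ->
  measurable_fun setT (xi i : history t -> Xi).
Proof.
move=> it _ B mB; rewrite setTI; apply: sub_sigma_algebra.
exists (fun k => if k == i then B else setT); first by move=> k; case: ifP.
apply/seteqP; split=> o /=; first by move=> Bo k _ /=; case: eqP => // ->.
by move=> /(_ i) /=; rewrite eqxx mem_iota; apply.
Qed.

Lemma measurable_history_le s t : (s <= t)%N ->
  measurable_fun setT (id : history t -> history s).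
Proof.
move=> st _ B mB; rewrite setTI preimage_id.
apply: (smallest_sub _ _ mB); first exact: sigma_algebra_measurable.
move=> _ [A mA ->]; apply: bigcap_measurableType => i.
rewrite /= mem_iota add0n => /= it.
rewrite -[X in measurable X]setTI.
by apply: (measurable_sample_history (leq_trans it st)).
Qed.

(** Dynkin's pi-lambda argument, starting from the product rule on cylinders. *)
Lemma history_indep t (A : set (history t)) (B : set Xi) :
  measurable A -> measurable B ->
  (P0 ((A : set O) `&` xi t @^-1` B) = P0 (A : set O) * P B)%E.
Proof.
move=> mA mB; have [mxi Pxi prodE] := iid.
have mxB := measurable_preimage_sample t mB.
have toO C : measurable (C : set (history t)) -> measurable (C : set O).
  by move=> mC; have := measurable_to_history (t := t) measurableT mC; rewrite setTI.
apply: (dynkin_induction (P := fun A : set (history t) =>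
  (P0 ((A : set O) `&` xi t @^-1` B) = P0 (A : set O) * P B)%E)
  (erefl : @measurable _ (history t) = <<s cylinders t >>)
  (@cylinders_setI t)) => //.
- by rewrite setTI probability_setT mul1e Pxi.
(* The product rule for [t.+1] samples, with [B] in place [t], is the rule for the first [t] samples
   times [P B]. *)
- move=> _ [C mC ->]; pose C' k := if k == t then B else C k.
  have mC' k : measurable (C' k) by rewrite /C'; case: ifP.
  have := prodE (iota 0 t.+1) C' (iota_uniq _ _) mC'.
  have iota_neq k : k \in iota 0 t -> C' k = C k.
    by rewrite mem_iota /C' => /andP[_ kt]; case: eqP kt => // ->; rewrite add0n ltnn.
  have C't : C' t = B by rewrite /C' eqxx.
  have := prodE (iota 0 t) C (iota_uniq _ _) mC.
  rewrite -[in iota 0 t.+1]addn1 iotaD add0n big_cat /= big_seq1 C't Pxi //.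
  rewrite [X in _ -> _ = (X * _)%E -> _](eq_big_seq (fun i => P0 (xi i @^-1` C i))); last first.
    by move=> k /iota_neq ->.
  move=> <- <-; congr (P0 _); apply/seteqP; split=> o /=.
    move=> [H Bo] k /=; rewrite mem_cat => /orP[kt|]; first by rewrite iota_neq //; exact: H.
    by rewrite inE => /eqP ->; rewrite C't.
  move=> H; split; last by rewrite -C't; apply: H; rewrite /= mem_cat mem_seq1 eqxx orbT.
  by move=> k kt; rewrite -iota_neq //; apply: H; rewrite /= mem_cat kt.
- move=> C mC HC.
  have mC' := toO _ mC.
  have -> : (~` C : set O) `&` xi t @^-1` B = xi t @^-1` B `\` (C : set O) by rewrite setDE setIC.
  rewrite measureD ?fin_num_measure // ?ltey_eq ?fin_num_measure //.
  rewrite probability_setC //; transitivity (P B - P0 (C : set O) * P B)%E.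
    by congr (_ - _)%E; [exact: Pxi|rewrite -HC; congr (P0 _); exact: setIC].
  by rewrite muleBl ?fin_num_measure // mul1e.
- move=> C mC tC HC.
  have mC' n : measurable (C n : set O) by exact: toO.
  rewrite setI_bigcupl measure_bigcup //; last 2 first.
  - by move=> n _; exact: measurableI.
  - by apply: trivIset_setIr.
  rewrite measure_bigcup // muleC.
  have -> : P B = (fine (P B))%:E by rewrite fineK // fin_num_measure.
  rewrite -nneseriesZl //.
  by apply: eq_eseriesr => n _; rewrite fineK ?fin_num_measure // muleC; exact: HC.
Qed.

(** * Products of factors with conditional expectation at most 1 *)

Section Supermartingale.
Variable Y : nat -> O * Xi -> R.
Hypothesis mY : forall t, measurable_fun setT (Y t : history t * Xi -> R).
Hypothesis Y0 : forall t u, 0 <= Y t u.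
Hypothesis Y1 : forall t o, (\int[P]_z (Y t (o, z))%:E <= 1)%E.

Let W t o := \prod_(s < t) Y s (o, xi s o).

Let mW t : measurable_fun setT (W t : history t -> R).
Proof.
apply: measurable_prod => i _.
have mi : measurable_fun setT ((fun o => (o, xi i o)) : history t -> history i * Xi).
  apply: measurable_fun_pair; first exact: (measurable_history_le (ltnW (ltn_ord i))).
  exact: measurable_sample_history.
exact: (measurableT_comp (@mY i) mi).
Qed.

Let W0 t o : 0 <= W t o.
Proof. by apply: prodr_ge0. Qed.

Lemma measurable_supermartingale t : measurable_fun setT (W t : O -> R).
Proof. exact: (measurableT_comp (@mW t) (@measurable_to_history t)). Qed.

(** [W t] depends on the past only, so integrating out [xi t] with the past frozen leaves [W t]
    times a factor at most 1. *)
Lemma integral_supermartingale t : (\int[P0]_o (W t o)%:E <= 1)%E.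
Proof.
elim: t => [|t IH].
  under eq_integral do rewrite /W big_ord0.
  rewrite integral_cst; last exact: measurableT.
  by rewrite mul1e; exact: probability_le1.
pose U (u : history t * Xi) := (W t u.1 * Y t u)%:E.
have mU : measurable_fun setT U.
  apply/measurable_EFinP/measurable_funM => //.
  exact: (measurableT_comp (@mW t) measurable_fst).
have U0 u : (0 <= U u)%E by rewrite lee_fin mulr_ge0.
have mxi : measurable_fun setT (xi t) by case: iid.
have -> : (\int[P0]_o (W t.+1 o)%:E = \int[P0]_o U (id o : history t, xi t o))%E.
  by apply: eq_integral => o _; rewrite /W big_ord_recr.
rewrite (integral_freezing (P := P) (@measurable_to_history t) mxi _ mU U0); last first.
  move=> A B mA mB; exact: history_indep.
apply: le_trans IH.
have mWE : measurable_fun setT (fun o : O => (W t o)%:E).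
  by apply/measurable_EFinP; exact: measurable_supermartingale.
apply: ge0_le_integral => //.
- by move=> o _; apply: integral_ge0.
- have := measurable_fun_fubini_tonelli_F (m2 := P) U mU U0.
  by move=> h; exact: (measurableT_comp h (@measurable_to_history t)).
move=> o _; rewrite /U /=.
under eq_integral do rewrite EFinM.
have mYo : measurable_fun setT (fun z => (Y t (o, z))%:E).
  by apply/measurable_EFinP; exact: (measurable_fun_pair2 (T1 := history t) o (@mY t)).
rewrite ge0_integralZl ?lee_fin //.
by rewrite -[leRHS]mule1; apply: lee_wpmul2l; rewrite ?lee_fin.
by move=> z _; rewrite lee_fin.
Qed.

End Supermartingale.

End History.

Section Tail.
Context {R : realType} {dO} {O : measurableType dO} (P0 : probability O R).

(** Markov's inequality: off the event [beta * W] exceeds 1, hence dominates the indicator of the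
    complement. *)
Lemma expectation_tail (W : O -> R) (beta : R) : 0 <= beta ->
  measurable_fun setT W -> (forall o, 0 <= W o) -> (\int[P0]_o (W o)%:E <= 1)%E ->
  measurable [set o | beta * W o <= 1] /\
  ((1 - beta)%:E <= P0 [set o | (beta * W o <= 1)%R])%E.
Proof.
move=> b0 mW W0 W1; set E := [set o | _].
have mbW : measurable_fun setT (fun o => beta * W o) by apply: measurable_funM.
have mE : measurable E by rewrite -[E]setTI; apply: measurable_fun_le.
split=> //; rewrite -[E]setCK probability_setC; last exact: measurableC.
rewrite EFinB; apply: leeB => //.
have mC : measurable (~` E) by exact: measurableC.
apply: (@le_trans _ _ (\int[P0]_o (\1_(~` E) o)%:E)%E).
  by rewrite integral_indic // setIT.
apply: (@le_trans _ _ (\int[P0]_o (beta%:E * (W o)%:E))%E).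
  apply: ge0_le_integral => //.
  - by apply/measurable_EFinP.
  - by apply/measurable_EFinP.
  move=> o _; rewrite -EFinM lee_fin indicE.
  have [/set_mem/negP|_] := boolP (o \in ~` E); last by rewrite mulr_ge0.
  by rewrite -ltNge => /ltW.
have mWE : measurable_fun setT (fun o => (W o)%:E) by apply/measurable_EFinP.
rewrite ge0_integralZl //.
by rewrite -[leRHS]mule1; apply: lee_wpmul2l.
by move=> o _; rewrite lee_fin.
Qed.

End Tail.

(** * The descent inequality *)

Section Descent.
Context {R : realType} {d : nat}.
Local Notation V := 'rV[R]_d.
Variables (nrm : V -> R) (X S : set V) (w : V -> R) (dw : V -> V).
Variables (F : V -> R) (gF : V -> V) (r : V -> R) (l : R).
Hypotheses (Hn : is_norm nrm) (cX : convex_set X) (Hw : is_DGF nrm X S w dw).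
Hypotheses (cr : convex_function setT r) (l0 : 0 < l).
Hypothesis smooth : rel_smooth (X `&` S) F gF l w dw.

(* The minimum defining the gap ranges over [closure S], relative smoothness
   over [S]: a point of the closure is approached along the segment from a
   relative interior point of [X], which stays in [S]. *)
Lemma Dgap_le (x : V) (a : R) : X x -> S x ->
  (forall y, X y -> S y -> a <= F y + r y + 4 * l * bregman w dw y x) ->
  Dgap X S gF r w dw (5 * l) x <= 10 * l * (F x + r x - a).
Proof.
move=> Xx Sx H; case: (Hw) => _ riS _ _ _.
suff : a - (F x + r x) <= inf [set gap_obj gF r w dw (5 * l) x y | y in X `&` closure S].
  by rewrite /Dgap => /(ler_wpM2l (ltW l0)); set I := inf _; lra.
apply: lb_le_inf; first exists (gap_obj gF r w dw (5 * l) x x), x => //.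
  by split=> //; exact: subset_closure.
move=> _ [y [Xy Sy] <-].
have [z riz] := rel_interior_neq0 cX Xx.
have [Xz _] := riz; have Sz := riS _ riz.
set gap := gap_obj gF r w dw (5 * l) x.
(* Convexity of the gap objective bounds it on the segment towards [z]; the claim is the limit as
   [t] tends to 0. *)
suff Ht t : 0 < t -> t <= 1 -> a - (F x + r x) <= gap y + t * (gap z - gap y).
  apply/ler_addgt0Pr => e e0; pose c := `|gap z - gap y| + 1.
  have c0 : 0 < c by rewrite ltr_wpDl.
  have t0 : 0 < Num.min 1 (e / c) by rewrite lt_min ltr01 divr_gt0.
  apply: le_trans (Ht _ t0 _) _; first by rewrite ge_min lexx.
  rewrite lerD2l; apply: (@le_trans _ _ (Num.min 1 (e / c) * c)).
    by rewrite ler_pM2l // (le_trans (ler_norm _)) // lerDl.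
  by rewrite -ler_pdivlMr // ge_min lexx orbT.
move=> t0 t1; pose yt := y + t *: (z - y).
have riyt : rel_interior X yt by apply: rel_interior_segment => //; rewrite t0.
have [Xyt _] := riyt; have Syt := riS _ riyt.
have t01 : 0 <= t <= 1 by rewrite ltW.
have h1 := H _ Xyt Syt.
(* Replacing [F yt] by its linearisation at [x] costs one more [l * bregman], which turns [4 * l]
   into [5 * l]. *)
have /andP[_ h2] := smooth (conj Xyt Syt) (conj Xx Sx).
have h3 := convex_function_segment y z cr t01.
have h4 := DGF_segment Hw Sy (subset_closure Sz) t01 (subset_closure Syt).
have h5 : 0 <= l * (t * (1 - t) / 2 * nrm (z - y) ^+ 2).
  rewrite mulr_ge0 ?(ltW l0) // mulr_ge0 ?sqr_ge0 // divr_ge0 // mulr_ge0 ?(ltW t0) //.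
  by rewrite subr_ge0.
have {}h4 := ler_wpM2l (ltW l0) h4.
move: h1 h2 h3 h4 h5; rewrite -/yt /gap /gap_obj /bregman.
rewrite /yt !(innerBr, innerDr, innerZr) -/yt.
move: (w yt) (w x) (w y) (w z) (r yt) (r x) (r y) (r z) (F yt) (F x) (nrm (z - y) ^+ 2).
move=> w1 w2 w3 w4 r1 r2 r3 r4 F1 F2 N.
move: (inner _ _) (inner _ _) (inner _ _) (inner _ _) (inner _ _) (inner _ _).
move=> i1 i2 i3 i4 i5 i6; lra.
Qed.

Definition step_noise (eta : R) (e v : V) : R :=
  4 * l * eta * inner e v + 4 * l * eta ^+ 2 * dual_norm nrm e ^+ 2
  - 6 * l ^+ 2 * eta * nrm v ^+ 2.

Lemma descent_step (eta : R) (g x xp u : V) :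
  0 < eta -> eta * l <= 1 / 2 -> X x -> S x -> X xp -> S xp -> X u -> S u ->
  (forall y, X y -> closure S y ->
     eta * (inner g xp + r xp) + bregman w dw xp x <=
     eta * (inner g y + r y) + bregman w dw y x) ->
  F u + r u + 4 * l * bregman w dw u xp + 4 * l * eta * (F xp + r xp) <=
  (1 + 4 * l * eta) * (F u + r u + 4 * l * bregman w dw u x)
    + step_noise eta (g - gF x) (u - x).
Proof.
move=> e0 el Xx Sx Xp Sp Xu Su H.
have h1 := mirror_step Hw (ltW e0) cX cr Sx Xp Sp H Xu.
have /andP[h2 _] := smooth (conj Xu Su) (conj Xx Sx).
have /andP[_ h3] := smooth (conj Xp Sp) (conj Xx Sx).
have h4 := bregman_ge Hw Sx (subset_closure Sp).
have h5 := bregman_ge Hw Sx (subset_closure Su).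
have := inner_le_dual_norm Hn (g - gF x) (x - xp).
have -> : nrm (x - xp) = nrm (xp - x) by rewrite -opprB is_normN.
rewrite /step_noise; set n := dual_norm _ _.
set N := nrm _ in h4 *; set Nu := nrm (u - x) in h5 *.
move: h1 h2 h3 h4 h5; set Dp := bregman w dw xp x; set Du := bregman w dw u x.
set Dup := bregman w dw u xp; rewrite !(innerBl, innerBr).
set gu := inner g u; set gp := inner g xp; set gx := inner g x.
set iu := inner _ u; set ip := inner _ xp; set ix := inner _ x.
move: (F u) (F xp) (F x) (r u) (r xp) => Fu Fp Fx ru rp h1 h2 h3 h4 h5 h6.
have Dp0 : 0 <= Dp by apply: le_trans h4; rewrite divr_ge0 ?sqr_ge0.
have {}h2 := ler_wpM2l (ltW e0) h2; have {}h3 := ler_wpM2l (ltW e0) h3.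
have {}h6 := ler_wpM2l (ltW e0) h6.
(* Half of [Dp] pays for the smoothness error; the other half, at least [N ^+ 2 / 4], pays for
   Young's inequality on [eta * n * N]. *)
have h7 : eta * l * Dp <= 1 / 2 * Dp by rewrite ler_wpM2r.
have h8 : 0 <= (eta * n - N / 2) ^+ 2 by exact: sqr_ge0.
have key : Dup + eta * (Fp + rp) <= Du + eta * (Fu + ru + l * Du)
    + eta * (gu - iu - (gx - ix)) + eta ^+ 2 * n ^+ 2.
  move: h1 h2 h3 h4 h6 h7 h8; lra.
have l40 : 0 <= 4 * l by rewrite mulr_ge0 // ltW.
have {}key := ler_wpM2l l40 key.
(* The factor [1 + 4 * l * eta] produces [16 * l ^+ 2 * eta * Du], of which [key] uses 4 parts; the
   other 12 yield the negative term of [step_noise] through [h5]. *)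
have l12 : 0 <= 12 * l ^+ 2 * eta by rewrite !mulr_ge0 ?sqr_ge0 // ltW.
have {}h5 := ler_wpM2l l12 h5.
move: key h5; lra.
Qed.

End Descent.

(** The potential is [a t - m + 4 * l * eta t * (phi t - m)]. Since [phi] stays above [m], its
    weight may drop from [eta t] to [eta t.+1]. *)
Lemma telescoping {R : realType} (a phi N eta : nat -> R) (m l eps : R) (T : nat) :
  0 <= l -> (forall t, eta t.+1 <= eta t) -> (forall t, m <= phi t) ->
  (forall t, a t.+1 + 4 * l * eta t * phi t.+1 <= (1 + 4 * l * eta t) * a t + N t + eps) ->
  \sum_(t < T) (4 * l * eta t * (phi t - a t)) + (a T - m) + 4 * l * eta T * (phi T - m) <=
  a 0%N - m + 4 * l * eta 0%N * (phi 0%N - m) + \sum_(t < T) N t + T%:R * eps.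
Proof.
move=> l0 eta_dec phim H; elim: T => [|T IH].
  by rewrite !big_ord0 mul0r add0r !addr0.
rewrite !big_ord_recr /= -[T.+1%:R]natr1.
have h : l * eta T.+1 * (phi T.+1 - m) <= l * eta T * (phi T.+1 - m).
  by rewrite ler_wpM2r ?subr_ge0 // ler_wpM2l.
have := H T; move: IH h; set S1 := \sum_(i < T) _; set S2 := \sum_(i < T) _.
move: (eta T) (eta T.+1) (phi T) (phi T.+1) (a T) (a T.+1) => e e' p p' b b'; lra.
Qed.

(** * Exponential moment of the noise of one step *)

Section NoiseExpectation.
Context {R : realType} {d : nat} {dX} {Xi : measurableType dX} (P : probability Xi R).
Local Notation V := 'rV[R]_d.
Variables (nrm : V -> R) (e : Xi -> V) (sigma l : R).
Hypotheses (Hn : is_norm nrm) (sigma0 : 0 < sigma) (l0 : 0 < l).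
Hypothesis ei : forall j, P.-integrable setT (fun z => (e z 0 j)%:E).
Hypothesis e0 : forall j, (\int[P]_z (e z 0 j)%:E = 0)%E.
Hypothesis subg : sub_gaussian P (fun z => dual_norm nrm (e z)) sigma.

Let me : vmeasurable e.
Proof. by move=> j; apply/measurable_EFinP; case/integrableP: (ei j). Qed.

Let inner_sum (b : V) :
  EFin \o (fun z => inner (e z) b) = (fun z => \sum_(j < d) (b 0 j)%:E * (e z 0 j)%:E)%E.
Proof.
by apply/funext => z /=; rewrite sumEFin; under [in RHS]eq_bigr do rewrite mulrC.
Qed.

Lemma integrable_inner (b : V) : P.-integrable setT (EFin \o (fun z => inner (e z) b)).
Proof. by rewrite inner_sum; apply: integrable_sum => // j _; exact: integrableZl. Qed.

Lemma integral_inner (b : V) : (\int[P]_z (inner (e z) b)%:E = 0)%E.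
Proof.
transitivity (\int[P]_z (EFin \o (fun z => inner (e z) b)) z)%E => //.
rewrite inner_sum integral_sum //; last by move=> j; exact: integrableZl.
by rewrite big1 // => j _; rewrite integralZl // e0 mule0.
Qed.

(** In [sub_gaussian_step] the quadratic term costs exactly the subtracted
    [10 * sigma ^+ 2 * l * eta ^+ 2]. By the choice of [th], the linear term costs [6 * l ^+ 2 * eta
    ^+ 2 / eta0 * nrm v ^+ 2], which the negative term covers because [eta <= eta0]. Both costs are
    in units of [th]. *)
Lemma step_noise_expectation (eta eta0 : R) (v : V) :
  0 < eta -> eta <= eta0 -> eta0 <= (2 * l)^-1 ->
  (\int[P]_z (expR ((8 * eta0 * sigma ^+ 2)^-1 *
     (step_noise nrm l eta (e z) v - 10 * sigma ^+ 2 * l * eta ^+ 2)))%:E <= 1)%E.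
Proof.
move=> eta_gt0 etale eta0l.
have eta0_gt0 : 0 < eta0 by exact: lt_le_trans etale.
have s2 : 0 < sigma ^+ 2 by rewrite exprn_gt0.
set th := (8 * eta0 * sigma ^+ 2)^-1.
have th0 : 0 < th by rewrite invr_gt0 !mulr_gt0.
pose a := th * (4 * l * eta ^+ 2).
pose c := th * (4 * l * eta).
have c0 : 0 <= c by rewrite !mulr_ge0 // ltW.
have a0 : 0 <= a by rewrite !mulr_ge0 ?sqr_ge0 // ltW.
have a1 : 5 / 2 * a <= sigma ^- 2.
  have -> : 5 / 2 * a = 5 / 4 * (eta * l * (eta / eta0)) * sigma ^- 2.
    by rewrite /a /th; field; rewrite !gt_eqF.
  rewrite ler_piMl ?invr_ge0 ?(ltW s2) //.
  have h1 : eta / eta0 <= 1 by rewrite ler_pdivrMr // mul1r.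
  have h2 : eta * l <= 1 / 2.
    have : eta <= (2 * l)^-1 by exact: le_trans eta0l.
    by rewrite -[_^-1]mul1r ler_pdivlMr ?mulr_gt0 //; lra.
  have h3 : eta * l * (eta / eta0) <= eta * l * 1.
    by rewrite ler_wpM2l // mulr_ge0 // ltW.
  lra.
pose b := c *: v.
have nb : nrm b = c * nrm v by rewrite is_normZ // ger0_norm.
pose K := th * (6 * l ^+ 2 * eta * nrm v ^+ 2 + 10 * sigma ^+ 2 * l * eta ^+ 2).
have mn : measurable_fun setT (fun z => dual_norm nrm (e z)).
  by apply: measurable_continuous_comp => // t; exact: dual_norm_continuous.
have := sub_gaussian_step mn (fun z => dual_norm_ge0 Hn (e z)) sigma0 subg
  (is_norm_ge0 Hn b) a0 a1 (integrable_inner b) (integral_inner b)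
  (fun z => norm_inner_le_dual_norm Hn (e z) b).
set I := (\int[P]_z _)%E => HI.
have -> : (\int[P]_z (expR (th *
    (step_noise nrm l eta (e z) v - 10 * sigma ^+ 2 * l * eta ^+ 2)))%:E =
    (expR (- K))%:E * I)%E.
  rewrite /I -ge0_integralZl //.
  - apply: eq_integral => z _; rewrite -EFinM -expRD; congr (expR _)%:E.
    by rewrite /step_noise /K /a /b innerZr /c; ring.
  - apply/measurable_EFinP/measurableT_comp => //; apply: measurable_funD.
      by apply: measurable_funM => //; exact: measurable_funX.
    by apply/measurable_EFinP; case/integrableP: (integrable_inner b).
apply: (le_trans (lee_wpmul2l _ HI)); first by rewrite lee_fin expR_ge0.
rewrite -EFinM lee_fin -expRD -[leRHS]expR0 ler_expR nb.
have -> : - K + (5 / 2 * a * sigma ^+ 2 + 3 * (c * nrm v) ^+ 2 * sigma ^+ 2) =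
    (eta / eta0 - 1) * (3 / 4 * l ^+ 2 * eta * nrm v ^+ 2 / (eta0 * sigma ^+ 2)).
  by rewrite /K /a /c /th; field; rewrite !gt_eqF.
rewrite mulr_le0_ge0 //; first by rewrite subr_le0 ler_pdivrMr // mul1r.
rewrite divr_ge0 //; last by rewrite mulr_ge0 // ltW.
rewrite mulr_ge0 ?sqr_ge0 // mulr_ge0 ?(ltW eta_gt0) // mulr_ge0 ?sqr_ge0 //.
Qed.

End NoiseExpectation.

(** * High-probability bound on the weighted sum of gaps *)

Theorem theorem2
  (R : realType) (d : nat)
  (* norm on R^d *)
  (nrm : 'rV[R]_d -> R) (Hnrm : is_norm nrm)
  (* feasible set *)
  (X : set 'rV[R]_d) (HXcl : closed X) (HXcv : convex_set X)
  (* DGF *)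
  (Sdom : set 'rV[R]_d) (w : 'rV[R]_d -> R) (dw : 'rV[R]_d -> 'rV[R]_d)
  (Hw : is_DGF nrm X Sdom w dw)
  (* data distribution and stochastic loss *)
  (dX : measure_display) (Xi : measurableType dX) (P : probability Xi R)
  (f : 'rV[R]_d -> Xi -> R) (gf : 'rV[R]_d -> Xi -> 'rV[R]_d)
  (F : 'rV[R]_d -> R) (gF : 'rV[R]_d -> 'rV[R]_d)
  (r : 'rV[R]_d -> R)
  (HFint : forall x, P.-integrable setT (fun z => (f x z)%:E))
  (HFexp : forall x, (F x)%:E = (\int[P]_z (f x z)%:E)%E)
  (HF : is_gradient_on setT F gF)
  (Hf : forall z, is_gradient_on X (fun x => f x z) (fun x => gf x z))
  (Hrcv : convex_function setT r) (Hrlsc : lower_semicontinuous (fun x => (r x)%:E))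
  (HPhi_lb : exists m : R, forall x, X x -> m <= F x + r x)
  (* minimizers defining D_rho exist *)
  (HDmin : forall (rho : R) x, 0 < rho -> X x -> Sdom x ->
     exists2 y, (X `&` closure Sdom) y &
       forall y', (X `&` closure Sdom) y' ->
         gap_obj gF r w dw rho x y <= gap_obj gF r w dw rho x y')
  (* relative smoothness *)
  (l : R) (Hl : 0 < l) (Hsmooth : rel_smooth (X `&` Sdom) F gF l w dw)
  (* stochastic oracle: unbiased, sub-Gaussian error *)
  (sigma : R) (Hsigma : 0 < sigma)
  (Hgf_meas : forall x (j : 'I_d), measurable_fun setT (fun z => gf x z 0 j))
  (Hunb : forall x (j : 'I_d), X x ->
     P.-integrable setT (fun z => (gf x z 0 j)%:E) /\
     (\int[P]_z (gf x z 0 j)%:E = (gF x 0 j)%:E)%E)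
  (Hsubg : forall x, X x ->
     sub_gaussian P (fun z => dual_norm nrm (gf x z - gF x)) sigma)
  (* the i.i.d. samples xi_0, xi_1, ... on a probability space *)
  (dO : measure_display) (O : measurableType dO) (P0 : probability O R)
  (xi : nat -> O -> Xi) (Hxi : iid_seq P0 xi P)
  (* step sizes *)
  (eta : nat -> R) (Heta_pos : forall t, 0 < eta t)
  (Heta_noninc : forall t, eta t.+1 <= eta t) (Heta0 : eta 0%N <= (2 * l)^-1)
  (* SMD iterates *)
  (x0 : 'rV[R]_d) (Hx0 : (X `&` Sdom) x0)
  (x : nat -> O -> 'rV[R]_d)
  (Hx_init : forall o, x 0%N o = x0)
  (Hx_step : forall t o,
     (X `&` Sdom) (x t.+1 o) /\
     forall y, (X `&` closure Sdom) y ->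
       eta t * (inner (gf (x t o) (xi t o)) (x t.+1 o) + r (x t.+1 o))
         + bregman w dw (x t.+1 o) (x t o)
       <= eta t * (inner (gf (x t o) (xi t o)) y + r y) + bregman w dw y (x t o))
  (Hx_meas : forall t (j : 'I_d), measurable_fun setT (fun o => x t o 0 j))
  (beta : R) (Hbeta : 0 < beta < 1) (T : nat) (HT : (1 <= T)%N) :
  let Phi := fun y => F y + r y in
  let Phistar := inf [set Phi y | y in X] in
  let lam0 := 3 * (Phi x0 - Phistar) + 8 * eta 0%N * sigma ^+ 2 * ln (beta^-1) in
  exists E : set O, [/\ measurable E, ((1 - beta)%:E <= P0 E)%E &
    forall o, E o ->
      (\sum_(t < T) eta t)^-1 *
        (\sum_(t < T) eta t * Dgap X Sdom gF r w dw (5 * l) (x t o))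
      <= (5 * lam0 + 60 * sigma ^+ 2 * l * \sum_(t < T) eta t ^+ 2)
           / (2 * \sum_(t < T) eta t)].

Proof.
move=> Phi Phistar lam0.
have [oS riS gw cdw sc] := Hw.
have Xx t o : X (x t o) /\ Sdom (x t o).
  by case: t => [|t]; [rewrite Hx_init|case: (Hx_step t o)].
have mf y : measurable_fun setT (f y).
  by apply/measurable_EFinP; case/integrableP: (HFint y).
have Phi_ge y : X y -> Phistar <= Phi y.
  move=> Xy; apply: ge_inf; last by exists y.
  by case: HPhi_lb => m Hm; exists m => _ [z /Hm Hz <-].
have eta_le t : eta t <= eta 0%N.
  by elim: t => // t; exact: le_trans.
have etal t : eta t * l <= 1 / 2.
  have : eta t <= (2 * l)^-1 by exact: le_trans (eta_le t) Heta0.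
  by rewrite -[_^-1]mul1r ler_pdivlMr ?mulr_gt0 //; lra.
have dw_coord (g : O -> 'rV[R]_d) o j : Sdom (g o) -> {for g o, continuous (fun y => dw y 0 j)}.
  move=> So; apply: (@continuous_comp _ _ _ dw (fun M : 'rV[R]_d => M 0 j)).
    exact: cdw.
  exact: coord_continuous.
(* Independence of [xi t] requires [x t] to be measurable for the past alone, not merely on [O]; the
   proof is by induction along the recursion. *)
have mx t : vmeasurable (x t : g_sigma_algebraType (cylinders xi t) -> 'rV[R]_d).
  elim: t => [|t IH].
    have -> : x 0%N = cst x0 by apply/funext => o; rewrite Hx_init.
    by move=> j; exact: measurable_cst.
  pose H := g_sigma_algebraType (cylinders xi t.+1).
  have mxS : vmeasurable (x t : H -> 'rV[R]_d).
    by move=> j; exact: (measurableT_comp (IH j) (measurable_history_le (xi := xi) (leqnSn t))).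
  have [c0 c00 c0P] := is_norm_ge Hnrm.
  have c20 : 0 < c0 ^+ 2 by rewrite exprn_gt0.
  have cc0 : 0 < (2 * c0 ^+ 2)^-1 by rewrite invr_gt0 mulr_gt0.
  pose p (o : H) := eta t *: gf (x t o) (xi t o) - dw (x t o).
  have mgf : vmeasurable (fun o : H => gf (x t o) (xi t o)).
    apply: (vmeasurable_gradient_comp mf Hf mxS) ; last first.
      exact: (measurable_sample_history (ltnSn t)).
    by move=> o; case: (Xx t o).
  have mp : vmeasurable p.
    move=> j.
    have -> : (fun o : H => p o 0 j) =
        (fun o => eta t * gf (x t o) (xi t o) 0 j - dw (x t o) 0 j).
      by apply/funext => o; rewrite !mxE.
    apply: measurable_funB; first exact: measurable_funM.
    apply: (measurable_continuous_comp (h := fun y => dw y 0 j) mxS) => o.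
    by apply: dw_coord; case: (Xx t o).
  (* Up to terms constant in [y], the mirror step minimises [eta t * r y + w y] plus the functional
     [p]. The three-point inequality, strong convexity and the comparison of norms give the
     quadratic growth. *)
  apply: (vmeasurable_minimizer (A := X `&` Sdom) (h := fun y => eta t * r y + w y) cc0 mp).
    by move=> o; case: (Hx_step t o).
  move=> o y [Xy Sy]; have [[Xp Sp] Hmin] := Hx_step t o; have [Xt St] := Xx t o.
  have h1 := mirror_step Hw (ltW (Heta_pos t)) HXcv Hrcv St Xp Sp
    (fun y Xy Sy => Hmin y (conj Xy Sy)) Xy.
  have h2 := bregman_ge Hw Sp (subset_closure Sy).
  have h3 : (2 * c0 ^+ 2)^-1 * `|y - x t.+1 o| ^+ 2 <= nrm (y - x t.+1 o) ^+ 2 / 2.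
    rewrite ler_pdivrMl ?mulr_gt0 //.
    have -> : 2 * c0 ^+ 2 * (nrm (y - x t.+1 o) ^+ 2 / 2) = (c0 * nrm (y - x t.+1 o)) ^+ 2.
      by field.
    by rewrite ler_pXn2r ?nnegrE ?c0P // mulr_ge0 ?(ltW c00) ?(is_norm_ge0 Hnrm).
  move: h1 (le_trans h3 h2); rewrite /p /bregman !(innerBl, innerBr, innerZl).
  set q := _^-1 * _; move: (w _) (w _) (w _) => w1 w2 w3; lra.
have T0 : 0 < T%:R :> R by rewrite ltr0n.
set S1 := \sum_(t < T) eta t; pose S2 := \sum_(t < T) eta t ^+ 2.
have S10 : 0 < S1.
  rewrite /S1; case: (T) HT => // T' _; rewrite big_ord_recl /=.
  by rewrite ltr_pwDl // sumr_ge0 // => i _; exact: ltW.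
have S20 : 0 < S2.
  rewrite /S2; case: (T) HT => // T' _; rewrite big_ord_recl /=.
  by rewrite ltr_pwDl ?exprn_gt0 // sumr_ge0 // => i _; exact: sqr_ge0.
have s20 : 0 < sigma ^+ 2 by rewrite exprn_gt0.
(* All errors together amount to at most [10 * T%:R * eps], that is [5 * sigma ^+ 2 * l * S2]:
   exactly the difference between the 25 given by the noise bound and the 30 of the statement. *)
pose eps := sigma ^+ 2 * l * S2 / (2 * T%:R).
have eps0 : 0 < eps by rewrite divr_gt0 ?mulr_gt0.
pose env t o y := F y + r y + 4 * l * bregman w dw y (x t o).
have envP t : exists u : O -> 'rV[R]_d, [/\ forall o, X (u o) /\ Sdom (u o),
    forall o y, X y -> Sdom y -> env t o (u o) <= env t o y + eps &
    vmeasurable (u : g_sigma_algebraType (cylinders xi t) -> 'rV[R]_d)].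
  pose p (o : g_sigma_algebraType (cylinders xi t)) := (- (4 * l)) *: dw (x t o).
  have mp : vmeasurable p.
    move=> j.
    have -> : (fun o => p o 0 j) = (fun o => - (4 * l) * dw (x t o) 0 j).
      by apply/funext => o; rewrite mxE.
    apply: measurable_funM => //.
    apply: (measurable_continuous_comp (h := fun y => dw y 0 j) (mx t)) => o.
    by apply: dw_coord; case: (Xx t o).
  pose h y := F y + r y + 4 * l * w y.
  have envE o y : h y + inner (p o) y =
      env t o y + 4 * l * (w (x t o) - inner (dw (x t o)) (x t o)).
    by rewrite /h /p /env /bregman innerZl innerBr; ring.
  have [||u [Au umin uK]] := measurable_near_minimizer (A := X `&` Sdom) (h := h) _ eps0 mp.
  - by exists x0.
  - move=> o; exists (Phistar + 4 * l * (w (x t o) - inner (dw (x t o)) (x t o))) => y [Xy Sy].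
    rewrite envE lerD2r /env; have [_ St] := Xx t o.
    have := Phi_ge y Xy; have := bregman_ge Hw St (subset_closure Sy).
    have := sqr_ge0 (nrm (y - x t o)); rewrite /Phi => h1 h2 h3.
    have : 0 <= 4 * l * bregman w dw y (x t o) by rewrite !mulr_ge0 // ?(ltW Hl) //; lra.
    lra.
  exists u; split=> //; last by move=> j; exact: (uK (fun q _ => q 0 j)).
  move=> o y Xy Sy; have := umin o y (conj Xy Sy); rewrite !envE; lra.
have /choice[u uP] := envP.
pose err t o z := gf (x t o) z - gF (x t o).
pose noise t o z := step_noise nrm l (eta t) (err t o z) (u t o - x t o).
pose th := (8 * eta 0%N * sigma ^+ 2)^-1.
have th0 : 0 < th by rewrite invr_gt0 !mulr_gt0.
pose Y t (q : O * Xi) := expR (th * (noise t q.1 q.2 - 10 * sigma ^+ 2 * l * eta t ^+ 2)).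
have mY t : measurable_fun setT (Y t : g_sigma_algebraType (cylinders xi t) * Xi -> R).
  pose Q : measurableType _ := (g_sigma_algebraType (cylinders xi t) * Xi)%type.
  have mxQ : vmeasurable (fun q : Q => x t q.1).
    by move=> j; exact: (measurableT_comp (mx t j) measurable_fst).
  have muQ : vmeasurable (fun q : Q => u t q.1 - x t q.1).
    move=> j; have [_ _ mu] := uP t.
    have -> : (fun q : Q => (u t q.1 - x t q.1) 0 j) = (fun q => u t q.1 0 j - x t q.1 0 j).
      by apply/funext => q; rewrite !mxE.
    by apply: measurable_funB => //; exact: (measurableT_comp (mu j) measurable_fst).
  have merr : vmeasurable (fun q : Q => err t q.1 q.2).
    move=> j.
    have -> : (fun q : Q => err t q.1 q.2 0 j) =
        (fun q => gf (x t q.1) q.2 0 j - gF (x t q.1) 0 j).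
      by apply/funext => q; rewrite !mxE.
    apply: measurable_funB.
      apply: (vmeasurable_gradient_comp mf Hf mxQ); last exact: measurable_snd.
      by move=> q; case: (Xx t q.1).
    (* The same lemma handles [gF], with [F] viewed as a loss constant in the sample. *)
    by apply: (vmeasurable_gradient_comp (f := fun y (_ : Xi) => F y)
      (gf := fun y _ => gF y) (X := setT) (xi := snd) _ _ mxQ).
  apply: measurableT_comp => //; apply: measurable_funM => //; apply: measurable_funB => //.
  apply: measurable_funB; first apply: measurable_funD.
  - by apply: measurable_funM => //; exact: measurable_inner.
  - apply: measurable_funM => //; apply: measurable_funX.
    by apply: (measurable_continuous_comp merr) => q; exact: dual_norm_continuous.
  - apply: measurable_funM => //; apply: measurable_funX.
    by apply: (measurable_continuous_comp muQ) => q; exact: is_norm_continuous.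
have Y0 t q : 0 <= Y t q by exact: expR_ge0.
have Y1 t o : (\int[P]_z (Y t (o, z))%:E <= 1)%E.
  have [Xt _] := Xx t o.
  have errE j : (fun z => (err t o z 0 j)%:E) =
      (fun z => (gf (x t o) z 0 j)%:E - (gF (x t o) 0 j)%:E)%E.
    by apply/funext => z; rewrite !mxE EFinB.
  have cst_int j : P.-integrable setT (fun=> (gF (x t o) 0 j)%:E).
    exact: finite_measure_integrable_cst.
  have err_int j : P.-integrable setT (fun z => (err t o z 0 j)%:E).
    by rewrite errE; have [gi _] := Hunb (x t o) j Xt; exact: integrableB.
  have err_mean j : (\int[P]_z (err t o z 0 j)%:E = 0)%E.
    have [gi gE] := Hunb (x t o) j Xt.
    rewrite errE integralB // gE integral_cst; last exact: measurableT.
    rewrite [X in (_ - _ * X)%E](_ : _ = 1%E); last exact: probability_setT.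
    by rewrite mule1 subee.
  exact: (step_noise_expectation (e := err t o) Hnrm Hsigma Hl err_int err_mean
    (Hsubg _ Xt) (u t o - x t o) (Heta_pos t) (eta_le t) Heta0).
have /andP[b0 b1] := Hbeta.
pose W o := \prod_(t < T) Y t (o, xi t o).
have W0 o : 0 <= W o by apply: prodr_ge0.
have [mE PE] := expectation_tail (ltW b0) (measurable_supermartingale Hxi mY T) W0
  (integral_supermartingale Hxi mY Y0 Y1 T).
exists [set o | beta * W o <= 1]; split=> // o; rewrite /= => Eo.
pose N t := noise t o (xi t o).
(* Logarithm of the inequality defining the event; [th^-1] is the factor in front of
   [ln beta^-1]. *)
have sumN : \sum_(t < T) N t <= 10 * sigma ^+ 2 * l * S2 + 8 * eta 0%N * sigma ^+ 2 * ln beta^-1.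
  have : th * (\sum_(t < T) N t - 10 * sigma ^+ 2 * l * S2) <= ln beta^-1.
    rewrite -ler_expR lnK ?posrE ?invr_gt0 // -[leRHS]mul1r ler_pdivlMr // mulrC.
    apply: le_trans Eo; rewrite ler_pM2l // /W /Y -expR_sum ler_expR.
    by rewrite /S2 mulr_sumr -sumrB mulr_sumr.
  rewrite /th ler_pdivrMl ?mulr_gt0 //; lra.
pose a t := env t o (u t o).
have tele := @telescoping R a (fun t => Phi (x t o)) N eta Phistar l eps T (ltW Hl) Heta_noninc.
have {tele} tele := tele (fun t => Phi_ge _ (Xx t o).1).
have {tele} tele : \sum_(t < T) 4 * l * eta t * (Phi (x t o) - a t) + (a T - Phistar)
    + 4 * l * eta T * (Phi (x T o) - Phistar) <=
    a 0%N - Phistar + 4 * l * eta 0%N * (Phi (x 0%N o) - Phistar) + \sum_(t < T) N t + T%:R * eps.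
  apply: tele => t.
  have [[Xt St] [Xp Sp]] := (Xx t o, Xx t.+1 o).
  have [uS umin _] := uP t; have [Xu Su] := uS o.
  have [_ umin' _] := uP t.+1.
  (* [u t] competes in the envelope at [x t.+1], at the cost of one [eps]; the descent step then
     bounds its value there. *)
  have h1 := umin' o (u t o) Xu Su.
  have [_ Hmin] := Hx_step t o.
  have h2 := descent_step Hnrm HXcv Hw Hrcv Hl Hsmooth (Heta_pos t) (etal t) Xt St Xp Sp Xu Su
    (fun y Xy Sy => Hmin y (conj Xy Sy)).
  move: h1 h2; rewrite /a /N /noise /err /Phi /env.
  set b1' := bregman _ _ _ _; set b2' := bregman _ _ _ _; set b3' := bregman _ _ _ _.
  set n := step_noise _ _ _ _ _; lra.
have a_ge t : Phistar <= a t.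
  have [uS _ _] := uP t; have [Xu Su] := uS o; have [_ St] := Xx t o.
  have := Phi_ge _ Xu; have := bregman_ge Hw St (subset_closure Su).
  have := sqr_ge0 (nrm (u t o - x t o)); rewrite /a /env /Phi => h1 h2 h3.
  have : 0 <= 4 * l * bregman w dw (u t o) (x t o) by rewrite !mulr_ge0 // ?(ltW Hl) //; lra.
  lra.
have a0 : a 0%N <= Phi x0 + eps.
  have [_ umin _] := uP 0%N; have [X0 S0] := Xx 0%N o.
  have := umin o _ X0 S0; rewrite /a /env /bregman !subrr inner0r.
  by rewrite subrr mulr0 addr0 Hx_init.
have gap_le t : eta t * Dgap X Sdom gF r w dw (5 * l) (x t o) <=
    5 / 2 * (4 * l * eta t * (Phi (x t o) - a t)) + 5 * eps.
  have [Xt St] := Xx t o; have [_ umin _] := uP t.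
  have := Dgap_le HXcv Hw Hrcv Hl Hsmooth (a := a t - eps) Xt St.
  have h y : X y -> Sdom y -> a t - eps <= F y + r y + 4 * l * bregman w dw y (x t o).
    by move=> Xy Sy; have := umin o y Xy Sy; rewrite /a /env; lra.
  move=> /(_ h) /(ler_wpM2l (ltW (Heta_pos t))).
  (* As [eta t * l <= 1 / 2], the error [10 * l * eta t * eps] is at most [5 * eps]. *)
  have := ler_wpM2r (ltW eps0) (etal t); rewrite /Phi; lra.
have sum_le : \sum_(t < T) eta t * Dgap X Sdom gF r w dw (5 * l) (x t o) <=
    5 / 2 * \sum_(t < T) (4 * l * eta t * (Phi (x t o) - a t)) + T%:R * (5 * eps).
  apply: le_trans (ler_sum _ (fun (t : 'I_T) _ => gap_le t)) _.
  by rewrite big_split /= -mulr_sumr sumr_const card_ord -[_ *+ T]mulr_natl.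
have epsE : T%:R * eps = sigma ^+ 2 * l * S2 / 2.
  by rewrite /eps; field; rewrite gt_eqF.
have T1 : eps <= T%:R * eps by rewrite ler_peMl ?(ltW eps0) // ler1n.
(* Origin of the factor 3 in [lam0]: 2 from this weight and 1 from [a 0%N]. *)
have D0 : 4 * l * eta 0%N * (Phi x0 - Phistar) <= 2 * (Phi x0 - Phistar).
  apply: ler_wpM2r; first by rewrite subr_ge0; apply: Phi_ge; case: Hx0.
  by have := etal 0%N; lra.
have PT : 0 <= 4 * l * eta T * (Phi (x T o) - Phistar).
  have : 0 <= 4 * l * eta T by rewrite !mulr_ge0 // ltW.
  by move=> /mulr_ge0; apply; rewrite subr_ge0; apply: Phi_ge; case: (Xx T o).
have aT := a_ge T.
rewrite Hx_init in tele.
rewrite ler_pdivrMl //.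
have -> : S1 * ((5 * lam0 + 60 * sigma ^+ 2 * l * S2) / (2 * S1)) =
    (5 * lam0 + 60 * sigma ^+ 2 * l * S2) / 2 by field; rewrite gt_eqF.
apply: le_trans sum_le _; rewrite /lam0 [T%:R * _]mulrCA.
move: tele sumN epsE T1 D0 PT aT a0.
set Q := \sum_(t < T) _; set M := \sum_(t < T) _.
move: (T%:R * eps) (ln _) => Te L; lra.
Qed.
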